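(* Let $R$ be a numerical semigroup ring of minimal multiplicity with homogeneous maximal ideal $\mathfrak m$ and canonical module $\omega_R$. Let $I$ be a nonprincipal homogeneous ideal of $R$ with minimal homogeneous generating set $x_1,\dots,x_n$, where $|x_i|<|x_{i+1}|$ for all $i$. Then the following are equivalent: (1) $\mathfrak m\operatorname{Ext}^1_R(I,\operatorname{Hom}_R(I,\omega_R))=0$. (2) $\mathfrak m\operatorname{Tor}^R_1(I,R/I)=0$. (3) $\mathfrak m\bigwedge^2_R(I)=0$. (4) $\mathfrak m B_1(I)\subseteq I Z_1(I)$. (5) $\operatorname{tr}_R(I)=\mathfrak m$. (6) $(x_1:I)=\mathfrak m$. (7) $\Omega^1_R(I)\cong\bigoplus_{i=2}^n\mathfrak m(-|x_i|)$ as graded $R$-modules. Moreover, in each of the conditions (1)-(4) one may replace $\mathfrak m$ by its minimal homogeneous reduction $(t^{a_1})$.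
   Context: Let $k$ be a field and $a_1<a_2<\dots<a_s$ positive integers with $\gcd(a_1,\dots,a_s)=1$. A numerical semigroup ring is either the positively graded ring $R=k[t^{a_1},\dots,t^{a_s}]$ (with $\deg t=1$) or its completion $k[\![t^{a_1},\dots,t^{a_s}]\!]$; $\mathfrak m=(t^{a_1},\dots,t^{a_s})$. In the complete case a homogeneous ideal means one extended from a homogeneous ideal of the graded ring, and statements about degrees or graded isomorphisms are understood over the graded ring. The multiplicity is $e(R)=a_1$; $R$ has minimal multiplicity if $e(R)=\mu_R(\mathfrak m)$, where $\mu_R$ is the minimal number of generators. $|x|$ denotes the degree of a homogeneous element $x$. The trace ideal is $\operatorname{tr}_R(I)=\langle f(u)\mid u\in I, f\in\operatorname{Hom}_R(I,R)\rangle$. $(x_1:I)=\{a\in R\mid aI\subseteq (x_1)\}$. $F=\bigoplus_{i=1}^n Re_i$ is the graded free module with $\deg e_i=|x_i|$, mapping onto $I$ by $e_i\mapsto x_i$; $Z_1(I)\subseteq F$ is the kernel of this map (first Koszul cycles) and $B_1(I)\subseteq Z_1(I)$ is the submodule generated by the elements $x_ie_j-x_je_i$ (first Koszul boundaries). $\Omega^1_R(I)$ is the first syzygy of $I$ (equal to $Z_1(I)$ as a graded module). $M(-d)$ denotes the graded shift, $M(-d)_j=M_{j-d}$. *)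

(* Defs.v *)
From HB Require Import structures.
From mathcomp Require Import all_boot all_order all_algebra.
From mathcomp Require Import boolp classical_sets functions.
From mathcomp Require Import freeg.

Set Implicit Arguments.
Unset Strict Implicit.
Unset Printing Implicit Defensive.

Import GRing.Theory.
Local Open Scope ring_scope.
Local Open Scope quotient_scope.

Section Submodules.
Context (R : comNzRingType).
Implicit Types (U V : lmodType R).

Definition submod_span_pred V (S : V -> Prop) : {pred V} := fun v =>
  `[< exists n (c : 'I_n -> R) (u : 'I_n -> V),
        (forall i, S (u i)) /\ v = \sum_i c i *: u i >].

Lemma submod_span_closed V (S : V -> Prop) : submod_closed (submod_span_pred S).
Proof.
split; first by apply/asboolP; exists 0, (fun=> 0), (fun=> 0); split=> [[]|] //;
  rewrite big_ord0.
move=> b v w /asboolP[n [c [u [Su ->]]]] /asboolP[m [e [z [Sz ->]]]].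
apply/asboolP; exists (n + m)%N.
exists (fun i => match fintype.split i with inl j => b * c j | inr j => e j end).
exists (fun i => match fintype.split i with inl j => u j | inr j => z j end); split.
  by move=> i; case: fintype.split.
rewrite big_split_ord /= scaler_sumr; congr (_ + _); apply: eq_bigr => i _.
  by rewrite -[lshift m i]/(unsplit (inl i)) unsplitK scalerA.
by rewrite -[rshift n i]/(unsplit (inr i)) unsplitK.
Qed.

HB.instance Definition _ V S :=
  GRing.isSubmodClosed.Build R V (@submod_span_pred V S) (@submod_span_closed V S).

Definition submod_span V (S : V -> Prop) : submodClosed V := submod_span_pred S.

Definition gen V n (u : 'I_n -> V) : submodClosed V :=
  submod_span (fun v => exists i, v = u i).

Definition fin_gen V := exists n (u : 'I_n -> V), forall v, v \in gen u.

Definition is_min_num_gens V (N : submodClosed V) n :=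
  (exists u : 'I_n -> V, gen u =i N) /\
  forall m (u : 'I_m -> V), gen u =i N -> (n <= m)%N.

Definition ker_lin_pred U V (f : {linear U -> V}) : {pred U} := fun u => f u == 0.

Lemma ker_lin_closed U V (f : {linear U -> V}) : submod_closed (ker_lin_pred f).
Proof.
split; rewrite ?unfold_in /ker_lin_pred ?linear0 // => b u v /eqP fu /eqP fv.
by rewrite unfold_in linearP fu fv scaler0 addr0.
Qed.

HB.instance Definition _ U V f :=
  GRing.isSubmodClosed.Build R U (@ker_lin_pred U V f) (ker_lin_closed f).

Definition ker_lin U V (f : {linear U -> V}) : submodClosed U := ker_lin_pred f.

Definition im_lin_pred U V (f : {linear U -> V}) : {pred V} := fun v =>
  `[< exists u, v = f u >].

Lemma im_lin_closed U V (f : {linear U -> V}) : submod_closed (im_lin_pred f).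
Proof.
split; first by apply/asboolP; exists 0; rewrite linear0.
move=> b v w /asboolP[u ->] /asboolP[z ->].
by apply/asboolP; exists (b *: u + z); rewrite linearP.
Qed.

HB.instance Definition _ U V f :=
  GRing.isSubmodClosed.Build R V (@im_lin_pred U V f) (im_lin_closed f).

Definition im_lin U V (f : {linear U -> V}) : submodClosed V := im_lin_pred f.

Definition preim_lin_pred U V (f : {linear U -> V}) (N : submodClosed V) :
  {pred U} := fun u => f u \in N.

Lemma preim_lin_closed U V (f : {linear U -> V}) (N : submodClosed V) :
  submod_closed (preim_lin_pred f N).
Proof.
split=> [|b u v fu fv]; first by rewrite -[_ \in _]/(f 0 \in N) linear0 rpred0.
by rewrite -[_ \in _]/(f (b *: u + v) \in N) linearP rpredD ?rpredZ.
Qed.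

HB.instance Definition _ U V f N :=
  GRing.isSubmodClosed.Build R U (@preim_lin_pred U V f N) (preim_lin_closed f N).

Definition preim_lin U V (f : {linear U -> V}) (N : submodClosed V) :
  submodClosed U := preim_lin_pred f N.

End Submodules.

Section SubModule.
Context (R : comNzRingType) (V : lmodType R) (N : submodClosed V).

Record submodule := Submodule { submodule_val :> V; _ : submodule_val \in N }.

HB.instance Definition _ := [isSub for submodule_val].
HB.instance Definition _ := [Choice of submodule by <:].
HB.instance Definition _ :=
  GRing.SubChoice_isSubLmodule.Build R V (mem N) submodule (submodClosedP N).

End SubModule.

Section QuotModule.
Context (R : comNzRingType) (V : lmodType R) (N : submodClosed V).

(* submodClosed V does not inherit from zmodClosed V. *)
Definition submod_zmod : {pred V} := fun v => v \in N.

Lemma submod_zmod_closed : zmod_closed submod_zmod.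
Proof. exact: GRing.submod_closedB (submodClosedP N). Qed.

HB.instance Definition _ :=
  GRing.isZmodClosed.Build V submod_zmod submod_zmod_closed.

Definition quot_module := Quotient.quot submod_zmod.
HB.instance Definition _ := GRing.Zmodule.on quot_module.

Definition proj (v : V) : quot_module := \pi_(Quotient.quot submod_zmod) v.

Lemma projP v w : proj v = proj w <-> v - w \in N.
Proof.
rewrite -[_ \in N]/(v - w \in submod_zmod) Quotient.idealrBE.
by split=> [/eqP|/eqP].
Qed.

Lemma projK (q : quot_module) : proj (repr (q : Quotient.quot submod_zmod)) = q.
Proof. exact: reprK. Qed.

Lemma proj_zmod_morphism : zmod_morphism proj.
Proof. by move=> v w; rewrite /proj raddfB. Qed.

Definition quot_scale (b : R) (q : quot_module) : quot_module :=
  proj (b *: repr (q : Quotient.quot submod_zmod)).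

Lemma proj_scale b v : quot_scale b (proj v) = proj (b *: v).
Proof. by apply/projP; rewrite -scalerBr rpredZ //; apply/projP/projK. Qed.

Lemma quot_scaleA b c q : quot_scale b (quot_scale c q) = quot_scale (b * c) q.
Proof. by rewrite -(projK q) !proj_scale scalerA. Qed.

Lemma quot_scale1 : left_id 1 quot_scale.
Proof. by move=> q; rewrite -(projK q) proj_scale scale1r. Qed.

Lemma projD v w : proj (v + w) = proj v + proj w.
Proof. by rewrite /proj raddfD. Qed.

Lemma quot_scaleDr : right_distributive quot_scale +%R.
Proof.
move=> b q r; rewrite -(projK q) -(projK r).
by rewrite -projD !proj_scale scalerDr projD.
Qed.

Lemma quot_scaleDl q : {morph quot_scale^~ q : b c / b + c}.
Proof. by move=> b c; rewrite -(projK q) !proj_scale scalerDl projD. Qed.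

HB.instance Definition _ := GRing.Zmodule_isLmodule.Build R quot_module
  quot_scaleA quot_scale1 quot_scaleDr quot_scaleDl.

Lemma proj_is_linear : linear proj.
Proof. by move=> b v w; rewrite projD -proj_scale. Qed.

HB.instance Definition _ := GRing.isLinear.Build R V quot_module _ proj
  proj_is_linear.

End QuotModule.

(* The homology at B of A -> B -> C. *)
Definition homology (R : comNzRingType) (A B C : lmodType R)
    (f : {linear A -> B}) (g : {linear B -> C}) : lmodType R :=
  quot_module (preim_lin (\val : submodule (ker_lin g) -> B) (im_lin f)).

Section HomModule.
Context (R : comNzRingType).
Implicit Types (M N U V : lmodType R).

Definition hom_pred U V : {pred (U -> V)} := fun f => `[< linear f >].

Lemma hom_closed U V : submod_closed (@hom_pred U V).
Proof.
split; first by apply/asboolP => b u v; rewrite /GRing.zero /= scaler0 addr0.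
move=> b f g /asboolP fl /asboolP gl; apply/asboolP => c u v.
change (b *: f (c *: u + v) + g (c *: u + v) =
  c *: (b *: f u + g u) + (b *: f v + g v)).
by rewrite fl gl !scalerDr !scalerA (mulrC b) addrACA.
Qed.

HB.instance Definition _ U V :=
  GRing.isSubmodClosed.Build R (U -> V) (@hom_pred U V) (@hom_closed U V).

Definition hom_submod U V : submodClosed (U -> V) := @hom_pred U V.

Definition hom_module U V : lmodType R := submodule (hom_submod U V).

Lemma hom_linear U V (f : hom_module U V) : linear (\val f).
Proof. by apply/asboolP; apply: (valP f). Qed.

Lemma precomp_in U V M (d : {linear U -> V}) (f : hom_module V M) :
  (\val f \o d) \in hom_submod U M.
Proof. by apply/asboolP => b u v; rewrite /= linearP hom_linear. Qed.

Definition precomp U V M (d : {linear U -> V}) (f : hom_module V M) : hom_module U M :=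
  Submodule (precomp_in d f).

Lemma precomp_linear U V M (d : {linear U -> V}) : linear (@precomp U V M d).
Proof. by move=> b f g; apply: val_inj; apply: funext. Qed.

HB.instance Definition _ U V M d := GRing.isLinear.Build R (hom_module V M) (hom_module U M)
  _ (@precomp U V M d) (precomp_linear d).

End HomModule.

Section Tensor.
Context (R : comNzRingType).
Implicit Types (U V M N : lmodType R).

Lemma fglift_is_linear (K : choiceType) M (f : K -> M) :
  linear (fglift f : {freeg K / R} -> M).
Proof.
pose F : {additive {freeg K / R} -> M} :=
  HB.pack (fglift f) (GRing.isZmodMorphism.Build _ _ _ (lift_is_additive f)).
move=> b D E; change (F (b *: D + E) = b *: F D + F E).
rewrite raddfD; congr (_ + _).
rewrite -[X in _ = _ *: F X]freeg_sumE.
rewrite -[b *: D]/(\sum_(x <- dom D) << b * coeff x D *g x >>).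
rewrite !raddf_sum; apply: eq_bigr => x _.
by rewrite /F /= !liftU scalerA.
Qed.

HB.instance Definition _ (K : choiceType) M (f : K -> M) :=
  GRing.isLinear.Build R {freeg K / R} M _ (fglift f) (fglift_is_linear f).

Inductive bilinear_relation U V : {freeg (U * V) / R} -> Prop :=
| BilinDl u u' v : bilinear_relation (<<(u + u', v)>> - <<(u, v)>> - <<(u', v)>>)
| BilinDr u v v' : bilinear_relation (<<(u, v + v')>> - <<(u, v)>> - <<(u, v')>>)
| BilinZl b u v : bilinear_relation (<<(b *: u, v)>> - b *: <<(u, v)>>)
| BilinZr b u v : bilinear_relation (<<(u, b *: v)>> - b *: <<(u, v)>>).

Definition tensor U V : lmodType R := quot_module (submod_span (@bilinear_relation U V)).

Definition tens U V (u : U) (v : V) : tensor U V := proj _ <<(u, v)>>.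

Lemma tens_span U V z : z \in submod_span (@bilinear_relation U V) ->
  proj (submod_span (@bilinear_relation U V)) z = 0.
Proof. by move=> zN; rewrite -(linear0 (proj _)); apply/projP; rewrite subr0. Qed.

Lemma submod_span_mem V (S : V -> Prop) v : S v -> v \in submod_span S.
Proof.
move=> Sv; apply/asboolP; exists 1%N, (fun=> 1), (fun=> v); split=> //.
by rewrite big_ord1 scale1r.
Qed.

Lemma tens_subr0 U V z : bilinear_relation z ->
  proj (submod_span (@bilinear_relation U V)) z = 0.
Proof. by move=> /submod_span_mem; exact: tens_span. Qed.

Lemma tensDl U V (u u' : U) (v : V) : tens (u + u') v = tens u v + tens u' v.
Proof.
apply/eqP; rewrite -subr_eq0 opprD addrA /tens -!linearB; apply/eqP.
exact: tens_subr0 (BilinDl _ _ _).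
Qed.

Lemma tensDr U V (u : U) (v v' : V) : tens u (v + v') = tens u v + tens u v'.
Proof.
apply/eqP; rewrite -subr_eq0 opprD addrA /tens -!linearB; apply/eqP.
exact: tens_subr0 (BilinDr _ _ _).
Qed.

Lemma tensZl U V b (u : U) (v : V) : tens (b *: u) v = b *: tens u v.
Proof.
apply/eqP; rewrite -subr_eq0 /tens -linearZ -linearB; apply/eqP.
exact: tens_subr0 (BilinZl _ _ _).
Qed.

Lemma tensZr U V b (u : U) (v : V) : tens u (b *: v) = b *: tens u v.
Proof.
apply/eqP; rewrite -subr_eq0 /tens -linearZ -linearB; apply/eqP.
exact: tens_subr0 (BilinZr _ _ _).
Qed.

Section TensorMap.
Context (U W V : lmodType R) (f : {linear U -> W}).

Let lift : {linear {freeg (U * V) / R} -> tensor W V} :=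
  fglift (fun uv => tens (f uv.1) uv.2).

Let liftE u v : lift <<(u, v)>> = tens (f u) v.
Proof. by rewrite /lift /= liftU scale1r. Qed.

Let liftB y z : lift (y - z) = lift y - lift z.
Proof. exact: raddfB. Qed.

Let liftZ b y : lift (b *: y) = b *: lift y.
Proof. exact: linearZ. Qed.

Definition tensor_map (q : tensor U V) : tensor W V :=
  lift (repr (q : Quotient.quot _)).

Lemma tensor_map_proj z : tensor_map (proj _ z) = lift z.
Proof.
set N := submod_span (@bilinear_relation U V).
have lift0 y : y \in N -> lift y = 0.
  move=> /asboolP[n [c [u [relu ->]]]]; rewrite linear_sum big1 // => i _.
  rewrite linearZ /=; have: lift (u i) = 0.
    case: (relu i) => [u1 u2 v|u1 v1 v2|b u1 v|b u1 v];
      rewrite !liftB ?liftZ !liftE.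
    - by rewrite linearD tensDl addrAC addrK subrr.
    - by rewrite tensDr addrAC addrK subrr.
    - by rewrite linearZ tensZl subrr.
    - by rewrite tensZr subrr.
  by move=> e; change (c i *: lift (u i) = 0); rewrite e scaler0.
apply/eqP; rewrite -subr_eq0 -linearB; apply/eqP/lift0/projP.
exact: projK.
Qed.

Lemma tensor_map_tens u v : tensor_map (tens u v) = tens (f u) v.
Proof. by rewrite tensor_map_proj liftE. Qed.

Lemma tensor_map_linear : linear tensor_map.
Proof.
move=> b q r; rewrite -(projK q) -(projK r) -linearP !tensor_map_proj.
by rewrite linearP.
Qed.

HB.instance Definition _ := GRing.isLinear.Build R (tensor U V) (tensor W V) _
  tensor_map tensor_map_linear.

End TensorMap.

Definition exterior_square U : lmodType R :=
  quot_module (submod_span (fun w : tensor U U => exists u, w = tens u u)).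

End Tensor.

Arguments tensor_map {R U W} V f.

(* Ext and Tor through the functorial free resolution
   ... -> R^(syz 2) -> R^(syz 1) -> R^(syz 0), where syz 0 = M and syz (i + 1) is
   the kernel of the canonical surjection R^(syz i) -> syz i. *)

Section ExtTor.
Context (R : comNzRingType).
Implicit Types (M N : lmodType R).

Definition free_cover M : {linear {freeg M / R} -> M} :=
  fglift (fun u : M => u).

Fixpoint syz M i : lmodType R :=
  if i is j.+1 then submodule (ker_lin (free_cover (syz M j))) else M.

Definition res M i : lmodType R := {freeg (syz M i) / R}.

Definition res_diff M i : {linear res M i.+1 -> res M i} :=
  (\val : submodule (ker_lin (free_cover (syz M i))) -> res M i)
    \o free_cover (syz M i.+1).

Definition Ext i M N : lmodType R :=
  if i is j.+1 then
    homology (precomp (M := N) (res_diff M j)) (precomp (M := N) (res_diff M j.+1))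
  else submodule (ker_lin (precomp (M := N) (res_diff M 0))).

Definition Tor i M N : lmodType R :=
  if i is j.+1 then
    homology (tensor_map N (res_diff M j.+1)) (tensor_map N (res_diff M j))
  else quot_module (im_lin (tensor_map N (res_diff M 0))).

Definition isomorphic M N := exists f : {linear M -> N}, bijective f.

End ExtTor.

Section Ideals.
Context (R : comNzRingType).
Implicit Types (I J : submodClosed R^o).

Definition annihilates J (M : lmodType R) :=
  forall b, b \in J -> forall u : M, b *: u = 0.

Definition ideal_mul (V : lmodType R) J (N : submodClosed V) : submodClosed V :=
  submod_span (fun v => exists b u, [/\ b \in J, u \in N & v = b *: u]).

Definition principal (b : R) : submodClosed R^o := submod_span (fun c : R^o => c = b).

Definition trace_ideal (M : lmodType R) : submodClosed R^o :=
  submod_span (fun c => exists (f : hom_module M R^o) (u : M), c = \val f u).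

(* (J : I) *)
Definition colon J I : {pred R^o} :=
  fun b => `[< forall c : R^o, c \in I -> b * c \in J >].

Definition koszul_map n (x : 'I_n -> R) (z : 'rV[R]_n) : R^o :=
  \sum_i z ord0 i * x i.

Lemma koszul_map_linear n (x : 'I_n -> R) : linear (koszul_map x).
Proof.
move=> b y z; rewrite /koszul_map scaler_sumr -big_split; apply: eq_bigr => i _.
by rewrite !mxE mulrDl -mulrA.
Qed.

HB.instance Definition _ n (x : 'I_n -> R) := GRing.isLinear.Build R 'rV[R]_n R^o
  _ (koszul_map x) (koszul_map_linear x).

Definition koszul_cycles n (x : 'I_n -> R) : submodClosed 'rV[R]_n :=
  ker_lin (koszul_map x).

Definition koszul_boundaries n (x : 'I_n -> R) : submodClosed 'rV[R]_n :=
  submod_span (fun z => exists i j,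
    z = x i *: delta_mx ord0 j - x j *: delta_mx ord0 i).

End Ideals.

Definition fps (k : fieldType) := nat -> k.

Section FormalPowerSeries.
Context (k : fieldType).
Implicit Types (f g h : fps k).

HB.instance Definition _ := GRing.Zmodule.copy (fps k) (nat -> k).

Definition fps_one : fps k := fun n => (n == 0%N)%:R.

Definition fps_mul f g : fps k := fun n => \sum_(i < n.+1) f i * g (n - i)%N.

Let trunc n f : {poly k} := \poly_(i < n.+1) f i.

Lemma fps_mul_trunc n f g i : (i <= n)%N ->
  fps_mul f g i = (trunc n f * trunc n g)`_i.
Proof.
move=> le_in; rewrite coefM; apply: eq_bigr => j _; rewrite !coef_poly !ltnS.
by rewrite (leq_trans (leq_ord j) le_in) (leq_trans (leq_subr j i) le_in).
Qed.

Lemma fps_mulC : commutative fps_mul.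
Proof.
by move=> f g; apply: funext => n; rewrite !(fps_mul_trunc _ _ (leqnn n)) mulrC.
Qed.

Lemma fps_mulA : associative fps_mul.
Proof.
move=> f g h; apply: funext => n.
transitivity ((trunc n f * trunc n g * trunc n h)`_n).
  rewrite -mulrA coefM; apply: eq_bigr => i _.
  by rewrite coef_poly ltn_ord -fps_mul_trunc ?leq_subr.
rewrite coefM; apply: eq_bigr => i _.
by rewrite -fps_mul_trunc -1?ltnS ?ltn_ord // coef_poly ltnS leq_subr.
Qed.

Lemma fps_mul1 : left_id fps_one fps_mul.
Proof.
move=> f; apply: funext => n; rewrite /fps_mul big_ord_recl mul1r subn0.
by rewrite big1 ?addr0 // => i _; rewrite /fps_one mul0r.
Qed.

Lemma fps_mulDl : left_distributive fps_mul +%R.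
Proof.
move=> f g h; apply: funext => n.
change (fps_mul (f + g) h n = fps_mul f h n + fps_mul g h n).
by rewrite /fps_mul -big_split; apply: eq_bigr => i _; rewrite mulrDl.
Qed.

Lemma fps_one_neq0 : fps_one != 0.
Proof.
by apply/eqP => /(congr1 (fun f : fps k => f 0)) /eqP; rewrite oner_eq0.
Qed.

HB.instance Definition _ := GRing.Zmodule_isComNzRing.Build (fps k)
  fps_mulA fps_mulC fps_mul1 fps_mulDl fps_one_neq0.

End FormalPowerSeries.

Section SemigroupRings.
Context (k : fieldType) (a : seq nat).

Definition semigroup (h : nat) : Prop :=
  exists c : 'I_(size a) -> nat, h = (\sum_i c i * nth 0 a i)%N.

Lemma semigroup0 : semigroup 0.
Proof. by exists (fun=> 0%N); rewrite big1. Qed.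

Lemma semigroupD h h' : semigroup h -> semigroup h' -> semigroup (h + h').
Proof.
move=> [c ->] [c' ->]; exists (fun i => c i + c' i)%N.
by rewrite -big_split; apply: eq_bigr => i _; rewrite mulnDl.
Qed.

(* sg_poly is k[t^a_1, ..., t^a_s]. *)

Definition sg_poly_pred : {pred {poly k}} :=
  fun p => `[< forall h, p`_h != 0 -> semigroup h >].

Lemma sg_poly_closed : subring_closed sg_poly_pred.
Proof.
split.
- by apply/asboolP => -[|h]; rewrite coef1 ?eqxx //= => _; apply: semigroup0.
- move=> p q /asboolP pS /asboolP qS; apply/asboolP => h; rewrite coefB.
  by have [p0|/pS //] := eqVneq p`_h 0; rewrite p0 sub0r oppr_eq0 => /qS.
- move=> p q /asboolP pS /asboolP qS; apply/asboolP => h; rewrite coefM.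
  apply: contraNP => hS; apply/eqP/big1 => i _.
  have [->|/pS iS] := eqVneq p`_i 0; first by rewrite mul0r.
  have [->|/qS jS] := eqVneq q`_(h - i) 0; first by rewrite mulr0.
  by case: hS; rewrite -(subnKC (leq_ord i)); apply: semigroupD.
Qed.

HB.instance Definition _ :=
  GRing.isSubringClosed.Build {poly k} sg_poly_pred sg_poly_closed.

Record sg_poly := SgPoly { sg_poly_val : {poly k}; _ : sg_poly_val \in sg_poly_pred }.

HB.instance Definition _ := [isSub for sg_poly_val].
HB.instance Definition _ := [Choice of sg_poly by <:].
HB.instance Definition _ :=
  GRing.SubChoice_isSubComNzRing.Build {poly k} (mem sg_poly_pred) sg_poly sg_poly_closed.

(* sg_fps is k[[t^a_1, ..., t^a_s]]. *)

Definition sg_fps_pred : {pred fps k} :=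
  fun f => `[< forall h, f h != 0 -> semigroup h >].

Lemma sg_fps_closed : subring_closed sg_fps_pred.
Proof.
split.
- by apply/asboolP => -[|h]; rewrite ?eqxx //= => _; apply: semigroup0.
- move=> p q /asboolP pS /asboolP qS; apply/asboolP => h.
  change (p h - q h != 0 -> semigroup h).
  by have [p0|/pS //] := eqVneq (p h) 0; rewrite p0 sub0r oppr_eq0 => /qS.
- move=> p q /asboolP pS /asboolP qS; apply/asboolP => h.
  apply: contraNP => hS; apply/eqP/big1 => i _.
  have [->|/pS iS] := eqVneq (p i) 0; first by rewrite mul0r.
  have [->|/qS jS] := eqVneq (q (h - i)%N) 0; first by rewrite mulr0.
  by case: hS; rewrite -(subnKC (leq_ord i)); apply: semigroupD.
Qed.

HB.instance Definition _ :=
  GRing.isSubringClosed.Build (fps k) sg_fps_pred sg_fps_closed.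

Record sg_fps := SgFps { sg_fps_val : fps k; _ : sg_fps_val \in sg_fps_pred }.

HB.instance Definition _ := [isSub for sg_fps_val].
HB.instance Definition _ := [Choice of sg_fps by <:].
HB.instance Definition _ :=
  GRing.SubChoice_isSubComNzRing.Build (fps k) (mem sg_fps_pred) sg_fps sg_fps_closed.

Lemma sg_completion_in (p : sg_poly) :
  ((fun h => (\val p)`_h) : fps k) \in sg_fps_pred.
Proof. by case: p => p /= /asboolP pS; apply/asboolP. Qed.

Definition sg_completion (p : sg_poly) : sg_fps := SgFps (sg_completion_in p).

(* t^h, or 0 when h is not in the semigroup. *)
Definition tpow (h : nat) : sg_poly := insubd (0 : sg_poly) ('X^h : {poly k}).

End SemigroupRings.

Arguments tpow {k a} h.

(* A grading of M is given by its homogeneous pieces; g j is the piece M_j. *)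

Section Gradings.
Context (k : fieldType) (a : seq nat).

Definition ring_grading : int -> sg_poly k a -> Prop :=
  fun j p => forall h : nat, (\val p)`_h != 0 -> h%:Z = j.

Definition homogeneous (d : nat) (p : sg_poly k a) := ring_grading d%:Z p.

End Gradings.

(* The grading of M(-d). *)
Definition shift_grading M (g : int -> M -> Prop) (d : nat) : int -> M -> Prop :=
  fun j u => g (j - d%:Z) u.

Definition sub_grading (R : comNzRingType) (V : lmodType R) (N : submodClosed V)
    (g : int -> V -> Prop) : int -> submodule N -> Prop :=
  fun j u => g j (\val u).

Definition row_grading M n (g : 'I_n -> int -> M -> Prop) : int -> 'rV[M]_n -> Prop :=
  fun j z => forall i, g i j (z ord0 i).

Definition sum_grading M n (g : 'I_n -> int -> M -> Prop) :
  int -> {ffun 'I_n -> M} -> Prop := fun j z => forall i, g i j (z i).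

Definition graded_isomorphic (R : comNzRingType) (M N : lmodType R)
    (g : int -> M -> Prop) (h : int -> N -> Prop) :=
  exists f : {linear M -> N}, bijective f /\ forall j u, g j u <-> h j (f u).

Inductive version := Graded | Complete.

Definition nsring (v : version) (k : fieldType) (a : seq nat) : comNzRingType :=
  match v with Graded => sg_poly k a | Complete => sg_fps k a end.

Definition of_graded (v : version) (k : fieldType) (a : seq nat) :
    sg_poly k a -> nsring v k a :=
  match v with Graded => id | Complete => @sg_completion k a end.

Arguments of_graded v {k a} p.

Section NumericalSemigroupRings.
Context (v : version) (k : fieldType) (a : seq nat).
Local Notation nsring := (nsring v k a).
Local Notation of_graded := (of_graded v).

Definition max_ideal : submodClosed nsring^o :=
  submod_span (fun c : nsring^o => exists2 h, h \in a & c = of_graded (tpow h)).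

(* a is sorted increasingly, so this is a_1. *)
Definition multiplicity : nat := head 0%N a.

Definition minimal_multiplicity := is_min_num_gens max_ideal multiplicity.

(* M is the direct sum of the M_j, and R_i M_j is contained in M_(i+j). *)
Definition is_grading (M : lmodType nsring) (g : int -> M -> Prop) :=
  [/\ forall j, g j 0 /\ forall u w, g j u -> g j w -> g j (u - w),
      forall i j p u, ring_grading i p -> g j u -> g (i + j) (of_graded p *: u),
      forall u, exists (s : seq int) (f : int -> M),
        (forall j, g j (f j)) /\ u = \sum_(j <- s) f j
    & forall (s : seq int) (f : int -> M), uniq s -> (forall j, g j (f j)) ->
        \sum_(j <- s) f j = 0 -> forall j, j \in s -> f j = 0].

Definition residue_field : lmodType nsring := quot_module max_ideal.

(* The ring is Cohen-Macaulay of dimension 1. For the graded ring this is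
   Bruns-Herzog, Definition 3.6.8, up to a degree shift; for the complete local
   ring it is Definition 3.3.1 (maximal Cohen-Macaulay of type 1 and of finite
   injective dimension), these invariants being read off the Ext^i(R/m, -). *)
Definition canonical_module (w : lmodType nsring) :=
  [/\ fin_gen w,
      v = Graded -> exists g : int -> w -> Prop, is_grading g,
      forall i, i != 1%N -> forall c : Ext i residue_field w, c = 0
    & isomorphic (Ext 1 residue_field w) residue_field].

End NumericalSemigroupRings.

Arguments max_ideal v k a : clear implicits.

(* Main.v *)
Require Import Defs.
From HB Require Import structures.
From mathcomp Require Import boolp functions.
From mathcomp Require Import freeg zify ring.
From mathcomp Require Import all_boot all_order all_algebra.

Set Implicit Arguments.
Unset Strict Implicit.
Unset Printing Implicit Defensive.

Import GRing.Theory.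
Local Open Scope ring_scope.

(** Let [S] be the semigroup and [e = a_1].  Minimal multiplicity means that
    [s + t - e] lies in [S] for all nonzero [s], [t] in [S].  Every condition is
    compared with the numerical condition that [d_j + e - d_1] lies in [S] for
    all [j], that is, [t^e] belongs to [(x_1 : I)].

    If it holds, then [m I] is contained in [x_1 m], so that multiplying a
    cycle, a wedge or a cocycle by an element of [m] makes it divisible by
    [x_1], and dividing by [x_1] solves the problem.

    If it fails, let [j] be minimal such that it fails, and let [J] be the ideal
    spanned by the [t^s] with [0 < s <> e] in [S].  Reading off the coefficients
    at [d_1] and [d_1 + e], or at [d_j] and [d_j + e], gives [R]-linear maps
    from [I] to [R / J], one killing [x_j] and the other killing [x_1]; they
    detect the Koszul relation of [x_1] and [x_j] multiplied by [t^e].  For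
    condition (1) a copy of [R / J] is needed inside [w / t^(2e) w]; it comes
    from [Ext^1(R / m, w) <> 0], while [Ext^1(I, w) = 0], a consequence of
    [Ext^2(R / m, w) = 0], lifts the second map to [I -> w].

    For condition (7), a syzygy has all its coordinates in [m], so dropping the
    first coordinate embeds the syzygies in the direct sum of the [m(-|x_i|)];
    an abstract graded isomorphism forces this embedding to be onto, degree by
    degree. *)

(** * Linear maps on submodules given as predicates *)

Section LinearOn.
Context (R : comNzRingType).
Implicit Types (U V W X : lmodType R).

Definition submod V (D : V -> Prop) :=
  D 0 /\ forall c u v, D u -> D v -> D (c *: u + v).

Definition lin_on U V (D : U -> Prop) (f : U -> V) :=
  forall c u v, D u -> D v -> f (c *: u + v) = c *: f u + f v.

Section Theory.
Context (U V : lmodType R) (D : U -> Prop) (f : U -> V).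
Hypotheses (Dsub : submod D) (flin : lin_on D f).

Lemma submodZ c u : D u -> D (c *: u).
Proof. by case: Dsub => D0 DD Du; rewrite -[_ *: _]addr0; apply: DD. Qed.

Lemma submodD u v : D u -> D v -> D (u + v).
Proof. by case: Dsub => D0 DD Du Dv; rewrite -[u]scale1r; apply: DD. Qed.

Lemma submodB u v : D u -> D v -> D (u - v).
Proof. by case: Dsub => D0 DD Du Dv; rewrite addrC -scaleN1r; apply: DD. Qed.

Lemma lin_on0 : f 0 = 0.
Proof.
have [D0 _] := Dsub.
by have := flin (-1) D0 D0; rewrite scaler0 addr0 scaleN1r addNr.
Qed.

Lemma lin_onZ c u : D u -> f (c *: u) = c *: f u.
Proof.
have [D0 _] := Dsub => Du.
by have := flin c Du D0; rewrite lin_on0 !addr0.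
Qed.

Lemma lin_onD u v : D u -> D v -> f (u + v) = f u + f v.
Proof. by move=> Du Dv; have := flin 1 Du Dv; rewrite !scale1r. Qed.

Lemma lin_onB u v : D u -> D v -> f (u - v) = f u - f v.
Proof. by move=> Du Dv; have := flin (-1) Dv Du; rewrite !scaleN1r ![- _ + _]addrC. Qed.

Lemma submod_ker : submod (fun u => D u /\ f u = 0).
Proof.
have [D0 DD] := Dsub; split; first by rewrite lin_on0.
move=> c u v [Du fu] [Dv fv]; split; first exact: DD.
by rewrite flin // fu fv scaler0 addr0.
Qed.

End Theory.

Lemma submodT V : submod (fun _ : V => True). Proof. by []. Qed.

Lemma lin_on_linear U V (D : U -> Prop) (f : {linear U -> V}) : lin_on D f.
Proof. by move=> c u v _ _; rewrite linearP. Qed.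

Lemma submod_ker_linear U V (f : {linear U -> V}) : submod (fun u => f u = 0).
Proof.
split=> [|c u v fu fv]; first by rewrite linear0.
by rewrite linearP fu fv scaler0 addr0.
Qed.

Definition linear_of U V (f : U -> V) (fl : linear f) : {linear U -> V} :=
  HB.pack f (GRing.isLinear.Build R U V _ f fl).

Lemma submod_span_ind V (S D : V -> Prop) : submod D -> (forall v, S v -> D v) ->
  forall v, v \in submod_span S -> D v.
Proof.
move=> [D0 DD] SD v /asboolP[n [c [u [Su ->]]]].
elim/big_ind: _ => // [x y Dx Dy|i _]; first by rewrite -[x]scale1r; apply: DD.
by rewrite -[_ *: _]addr0; apply: DD => //; apply: SD.
Qed.

Lemma submod_in V (N : submodClosed V) : submod (fun v => v \in N).
Proof. by split=> [|c u v Nu Nv]; rewrite ?rpred0 // rpredD ?rpredZ. Qed.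

Lemma proj_eq0 V (N : submodClosed V) v : proj N v = 0 <-> v \in N.
Proof.
rewrite -(linear0 (proj N)); split=> [/projP|?]; first by rewrite subr0.
by apply/projP; rewrite subr0.
Qed.

Lemma projZ V (N : submodClosed V) c v : c *: proj N v = proj N (c *: v).
Proof. by rewrite linearZ. Qed.

Lemma quot_surj V (N : submodClosed V) (q : quot_module N) : exists v, q = proj N v.
Proof. by exists (repr (q : Quotient.quot _)); rewrite projK. Qed.

Lemma freegU_scale (K : choiceType) (c : R) (x : K) :
  <<c *g x>> = c *: <<x>> :> {freeg K / R}.
Proof. by apply/eqP/freeg_eqP => z; rewrite coeffZ !coeffU mul1r. Qed.

Lemma freegE (K : choiceType) (z : {freeg K / R}) :
  z = \sum_(x <- dom z) coeff x z *: <<x>>.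
Proof. by rewrite -[LHS]freeg_sumE; apply: eq_bigr => x _; rewrite freegU_scale. Qed.

Lemma fgliftU (K : choiceType) V (f : K -> V) x : fglift f <<x>> = f x.
Proof. by rewrite liftU scale1r. Qed.

Lemma freeg_ind (K : choiceType) (D : {freeg K / R} -> Prop) :
  submod D -> (forall x, D <<x>>) -> forall z, D z.
Proof.
move=> [D0 DD] Dx z; rewrite [z]freegE.
elim/big_ind: _ => // [x y Dx' Dy|i _]; first by rewrite -[x]scale1r; apply: DD.
by rewrite -[_ *: _]addr0; apply: DD.
Qed.

Lemma fglift_comp (K : choiceType) V W (D : V -> Prop) (f : K -> V) (h : V -> W) z :
  submod D -> lin_on D h -> (forall x, D (f x)) ->
  D (fglift f z) /\ h (fglift f z) = fglift (h \o f) z.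
Proof.
move=> Ds hl Df; elim/freeg_ind: z => [|x]; last by rewrite !fgliftU; split.
split=> [|c y z [Dy ey] [Dz ez]]; first by rewrite !linear0 (lin_on0 Ds hl); case: Ds.
by rewrite !linearP hl //= ey ez; split=> //; apply: Ds.2.
Qed.

End LinearOn.

(** * Annihilators of Ext and Tor *)

Section ExtTorCriteria.
Context (R : comNzRingType).
Implicit Types (M N U V W X : lmodType R).

Lemma coverU M (u : M) : free_cover M <<u>> = u.
Proof. exact: fgliftU. Qed.

Lemma coverZ M (c : R) (z : {freeg M / R}) :
  free_cover M (c *: z) = c *: free_cover M z.
Proof. by rewrite linearZ. Qed.

Lemma coverB M (z z' : {freeg M / R}) :
  free_cover M (z - z') = free_cover M z - free_cover M z'.
Proof. by rewrite linearB. Qed.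

Lemma cover_ker M (z : submodule (ker_lin (free_cover M))) :
  free_cover M (\val z) = 0.
Proof. by case: z => z /= /eqP. Qed.

Lemma cover_val M i (z : syz M i.+1) : free_cover (syz M i) (\val z) = 0.
Proof. by case: z => z /= /eqP. Qed.

(** A cocycle kills the image of [res M j.+2], so it amounts to a linear map [g] on the kernel of
    the cover of [syz M j]; the coboundaries are the [g] that extend to the whole free module. *)
Lemma Ext_annP (b : R) M N j : (forall c : Ext j.+1 M N, b *: c = 0) <->
  forall g : res M j -> N, lin_on (fun z => free_cover (syz M j) z = 0) g ->
  exists G : {linear res M j -> N},
    forall z, free_cover (syz M j) z = 0 -> G z = b *: g z.
Proof.
split=> [b0 g glin | ext c].
- have phil : linear (fun y : res M j.+1 => g (\val (free_cover (syz M j.+1) y))).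
    by move=> c y z; rewrite linearP /= glin //; apply: cover_val.
  have phiin : (fun y : res M j.+1 => g (\val (free_cover (syz M j.+1) y))) \in
      hom_submod (res M j.+1) N by apply/asboolP.
  pose phi : hom_module (res M j.+1) N := Submodule phiin.
  have phi0 : phi \in ker_lin (precomp (M := N) (res_diff M j.+1)).
    apply/eqP/val_inj/funext => y /=.
    change (g (\val (free_cover (syz M j.+1) (\val (free_cover (syz M j.+2) y)))) = 0).
    rewrite cover_val linear0; apply: (lin_on0 _ glin).
    exact: submod_ker_linear.
  have := b0 (proj _ (Submodule phi0)); rewrite projZ => /proj_eq0.
  move=> /asboolP[G eG].
  exists (linear_of (hom_linear G)) => z z0 /=.
  have zin : z \in ker_lin (free_cover (syz M j)) by apply/eqP.
  pose z' : syz M j.+1 := Submodule zin.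
  have := congr1 (fun h : hom_module (res M j.+1) N => \val h <<z'>>) eG.
  change (b *: g (\val (free_cover (syz M j.+1) <<z'>>)) =
    \val G (\val (free_cover (syz M j.+1) <<z'>>)) -> \val G z = b *: g z).
  by rewrite coverU => <-.
- have [s ->] := quot_surj (c : quot_module _).
  case: s => -[phi phil] phi0.
  have phi00 y : phi (\val (free_cover (syz M j.+2) y)) = 0.
    by move/eqP/(congr1 (fun h => \val h y)): phi0.
  have ker0 y : free_cover (syz M j.+1) y = 0 -> phi y = 0.
    move=> y0; have yin : y \in ker_lin (free_cover (syz M j.+1)) by apply/eqP.
    by rewrite -(phi00 <<(Submodule yin : syz M j.+2)>>) coverU.
  have phil' : linear phi by apply/asboolP.
  pose Phi := linear_of phil'.
  have phiE (y : res M j.+1) z :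
      free_cover (syz M j.+1) y = free_cover (syz M j.+1) z -> phi y = phi z.
    move=> yz; apply/eqP; rewrite -subr_eq0; apply/eqP.
    rewrite -[LHS]/(Phi y - Phi z) -linearB; apply: ker0.
    by rewrite linearB yz subrr.
  pose cls z : syz M j.+1 := insubd (0 : syz M j.+1) z.
  have clsE z : free_cover (syz M j) z = 0 -> \val (cls z) = z.
    by move=> z0; rewrite insubdK //; apply/eqP.
  have [|G eG] := ext (fun z => phi <<cls z>>).
    move=> c' y z y0 z0; rewrite -[RHS](linearP Phi) /=; apply: phiE.
    rewrite linearP !coverU; apply: val_inj.
    rewrite -[RHS]/(c' *: \val (cls y) + \val (cls z)).
    by rewrite !clsE // linearP y0 z0 scaler0 addr0.
  rewrite projZ; apply/proj_eq0/asboolP.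
  have Gin : (G : _ -> _) \in hom_submod (res M j) N by apply/asboolP => *; exact: linearP.
  exists (Submodule Gin); apply: val_inj; apply: funext => y.
  change (b *: phi y = G (\val (free_cover (syz M j.+1) y))).
  rewrite eG ?cover_val //; congr (_ *: _); apply: phiE.
  by rewrite coverU; apply: val_inj; rewrite clsE // cover_val.
Qed.

Lemma Ext0_eq0P M N : (forall c : Ext 0 M N, c = 0) ->
  forall g : {linear M -> N}, forall u, g u = 0.
Proof.
move=> E0 g u.
have phiin : (g \o free_cover M) \in hom_submod (res M 0) N.
  by apply/asboolP => c y z; rewrite linearP.
have phi0 : Submodule phiin \in ker_lin (precomp (M := N) (res_diff M 0)).
  apply/eqP/val_inj/funext => y /=.
  change (g (free_cover M (\val (free_cover (syz M 1) y))) = 0).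
  by rewrite cover_ker linear0.
have := congr1 (fun h => \val (\val h) <<u>>) (E0 (Submodule phi0)).
change (g (free_cover M <<u>>) = 0 -> g u = 0).
by rewrite coverU.
Qed.

End ExtTorCriteria.

Section TensorQuotient.
Context (R : comNzRingType) (I : submodClosed R^o).
Implicit Types (M N U V W X : lmodType R).
Local Notation one := (proj I (1 : R^o)).

Lemma proj_ideal (c : R) : c *: one = proj I (c : R^o).
Proof. by rewrite projZ /GRing.scale /= mulr1. Qed.

Lemma tens_quot_surj U (z : tensor U (quot_module I)) : exists u, z = tens u one.
Proof.
have [y ->] := quot_surj (z : quot_module _).
elim/freeg_ind: y => [|[u q]]; last first.
  have [c ->] := quot_surj q.
  by rewrite -proj_ideal; exists (c *: u); rewrite tensZl -tensZr.
split=> [|c y z' [u eu] [u' eu']].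
  by exists 0; rewrite linear0 -(scale0r (0 : U)) tensZl scale0r.
by exists (c *: u + u'); rewrite linearP tensDl tensZl; congr (_ *: _ + _).
Qed.

(** For a free module [F], tensoring with [R / I] gives [F / I F], and membership in [I F] is read
    off the coordinates. *)
Lemma tens_quot_eq0 (K : choiceType) (f : {freeg K / R}) :
  tens f one = 0 <-> forall u, coeff u f \in I.
Proof.
split=> [f0 u | fI].
- pose L : {linear {freeg ({freeg K / R} * quot_module I) / R} -> quot_module I} :=
    fglift (fun p => coeff u p.1 *: p.2).
  have LU p : L <<p>> = coeff u p.1 *: p.2 by rewrite /L /= fgliftU.
  have : L <<(f, one)>> = 0.
    move/proj_eq0: f0; apply: (submod_span_ind (submod_ker_linear L)).
    move=> _ [g g' q|g q q'|b g q|b g q]; rewrite ?linearB ?linearZ !LU /=.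
    - by rewrite coeffD scalerDl addrAC addrK subrr.
    - by rewrite scalerDr addrAC addrK subrr.
    - by rewrite coeffZ scalerN scalerA subrr.
    - by rewrite scalerN !scalerA mulrC subrr.
  by rewrite LU /= proj_ideal => /proj_eq0.
- pose D (g : {freeg K / R}) := tens g one = 0.
  have DS : submod D.
    split=> [|c g h g0 h0]; first by rewrite /D -(scale0r (0 : {freeg K / R})) tensZl scale0r.
    by rewrite /D tensDl tensZl g0 h0 scaler0 addr0.
  rewrite -[tens f one = 0]/(D f) [f]freegE; elim/big_ind: _ => [|g h|x _].
  + by case: DS.
  + exact: submodD.
  rewrite /D tensZl -tensZr proj_ideal (_ : proj I _ = 0); last exact/proj_eq0.
  by rewrite -(scale0r (0 : quot_module I)) tensZr scale0r.
Qed.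

Lemma tens_quotB (K : choiceType) (b : R) (f s : {freeg K / R}) :
  (forall u, coeff u s \in I) -> tens (b *: f - s) one = b *: tens f one.
Proof.
move=> /tens_quot_eq0 s0.
by rewrite -scaleN1r tensDl !tensZl s0 scaler0 addr0.
Qed.

(** With [K] the kernel of the cover [F -> M], this Tor module is the intersection of [K] and [I F]
    modulo [I K]. *)
Lemma Tor1_annP (b : R) M : (forall c : Tor 1 M (quot_module I), b *: c = 0) <->
  forall z : {freeg M / R}, free_cover M z = 0 -> (forall u, coeff u z \in I) ->
    b *: z \in ideal_mul I (ker_lin (free_cover M)).
Proof.
split=> [b0 z z0 zI | bz c].
- have zin : z \in ker_lin (free_cover M) by apply/eqP.
  pose z' : syz M 1 := Submodule zin.
  have cyc : tens <<z'>> one \in ker_lin (tensor_map (quot_module I) (res_diff M 0)).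
    apply/eqP; apply: (etrans (tensor_map_tens _ _ _)).
    change (tens (\val (free_cover (syz M 1) <<z'>>)) one = 0).
    by rewrite coverU; apply/tens_quot_eq0.
  have := b0 (proj _ (Submodule cyc)); rewrite projZ => /proj_eq0/asboolP[y].
  have [w ->] := tens_quot_surj y; move/(fun e => etrans e (tensor_map_tens _ _ _)).
  change (b *: tens <<z'>> one = tens (\val (free_cover (syz M 2) w)) one ->
    b *: z \in ideal_mul I (ker_lin (free_cover M))).
  set d := \val _ => /eqP; rewrite -tensZl -subr_eq0.
  have -> t t' : tens t one - tens t' one = tens (t - t') one :> tensor (res M 1) _.
    by rewrite tensDl -scaleN1r -tensZl scaleN1r.
  move=> /eqP/tens_quot_eq0; set s := _ - _ => sI.
  have es : \val (free_cover (syz M 1) s) = b *: z.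
    by rewrite /s linearB linearZ coverU cover_val subr0.
  rewrite -es [s]freegE linear_sum raddf_sum; apply: rpred_sum => x _.
  apply: submod_span_mem; exists (coeff x s), (\val x); split=> //; first exact: valP.
  by rewrite linearZ /= coverU.
- have [t ->] := quot_surj (c : quot_module _).
  case: t => t; have [f ->] := tens_quot_surj t => cyc.
  have : tens (\val (free_cover (syz M 1) f)) one = 0.
    exact: etrans (esym (tensor_map_tens _ _ _)) (eqP cyc).
  move=> /tens_quot_eq0 fI.
  have := bz _ (cover_ker _) fI.
  (* [D] contains [I K]; the lift [s] it provides corrects [b *: f] to a cycle without changing its
     tensor. *)
  pose D (v : {freeg M / R}) := exists2 s : res M 1,
    forall u, coeff u s \in I & \val (free_cover (syz M 1) s) = v.
  have DS : submod D.
    split; first by exists 0; rewrite ?linear0 // => u; rewrite coeff0; apply: (submod_in I).1.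
    move=> c' u v [s sI <-] [s' s'I <-]; exists (c' *: s + s'); rewrite ?linearP //.
    by move=> x; rewrite coeffD coeffZ; apply: (submod_in I).2.
  case/(submod_span_ind DS) => [_ [b' [u [b'I uK ->]]]|s sI es].
    exists (b' *: <<(Submodule uK : syz M 1)>>); last by rewrite linearZ /= coverU.
    move=> x; rewrite coeffZ coeffU mul1r mulrC.
    exact: (submodZ (submod_in I) _ b'I).
  have yin : b *: f - s \in ker_lin (free_cover (syz M 1)).
    by apply/eqP/val_inj; rewrite linearB linearZ /= es subrr.
  rewrite projZ; apply/proj_eq0/asboolP.
  exists (tens <<(Submodule yin : syz M 2)>> one).
  apply: etrans (esym (tensor_map_tens _ _ _)).
  change (b *: tens f one =
    tens (\val (free_cover (syz M 2) <<(Submodule yin : syz M 2)>>)) one).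
  by rewrite coverU; apply: esym; apply: tens_quotB.
Qed.

End TensorQuotient.

(** * Vanishing of the first Ext module *)

Section Ext1Vanishing.
Context (R : comNzRingType) (W : lmodType R).
Implicit Types (M N U V X : lmodType R).

Definition extendable X (D N : X -> Prop) := forall g : X -> W, lin_on N g ->
  exists2 G : X -> W, lin_on D G & forall x, N x -> G x = g x.

(* [Ext^1(I, W) = 0] for a submodule [I] of [V], tested on all short exact
   sequences [0 -> ker p -> D -> I -> 0]; carrying submodules as predicates
   avoids maps between subtypes. *)
Definition Ext1_zero V (I : V -> Prop) := forall X (D : X -> Prop) (p : X -> V),
  submod D -> lin_on D p -> (forall x, D x -> I (p x)) ->
  (forall v, I v -> exists2 x, D x & p x = v) ->
  extendable D (fun x => D x /\ p x = 0).

Lemma eq_Ext1_zero V (I J : V -> Prop) : (forall v, I v <-> J v) ->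
  Ext1_zero I -> Ext1_zero J.
Proof.
move=> IJ I0 X D p Ds pl DJ JD; apply: I0 => // [x /DJ /IJ|v /IJ /JD] //.
Qed.

Lemma Ext1_zero_iso U V (I : U -> Prop) (J : V -> Prop) (q : U -> V) :
  submod I -> lin_on I q -> (forall u, I u -> J (q u)) ->
  (forall v, J v -> exists2 u, I u & q u = v) ->
  (forall u, I u -> q u = 0 -> u = 0) -> Ext1_zero J -> Ext1_zero I.
Proof.
move=> Is ql IJ JI q0 J0 X D p Ds pl DI ID g gl.
have [|x Dx|v /JI[u /ID[x Dx <-] <-]|c x y [Dx px] [Dy py]|G Gl eG] :=
    J0 X D (q \o p) Ds _ _ _ g.
- by move=> c x y Dx Dy; rewrite /= pl // ql //; apply: DI.
- exact/IJ/DI.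
- by exists x.
- by apply: gl; split=> //; apply: q0 => //; apply: DI.
by exists G => // x [Dx px]; apply: eG; split=> //=; rewrite px (lin_on0 Is ql).
Qed.

(** The map is extended first to the preimage of the kernel of [q], then from there to [D], the
    quotient being [J]. *)
Lemma Ext1_zero_extension U V (I : U -> Prop) (J : V -> Prop) (q : U -> V) :
  submod I -> lin_on I q -> (forall u, I u -> J (q u)) ->
  (forall v, J v -> exists2 u, I u & q u = v) ->
  Ext1_zero (fun u => I u /\ q u = 0) -> Ext1_zero J -> Ext1_zero I.
Proof.
move=> Is ql IJ JI K0 J0 X D p Ds pl DI ID g gl.
have qpl : lin_on D (q \o p) by move=> c x y Dx Dy; rewrite /= pl // ql //; apply: DI.
have [|||||G Gl eG] := K0 X (fun x => D x /\ (q \o p) x = 0) p _ _ _ _ g.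
- exact: submod_ker Ds qpl.
- by move=> c x y [Dx _] [Dy _]; apply: pl.
- by move=> x [Dx qpx]; split=> //; apply: DI.
- by move=> v [/ID[x Dx <-] qv]; exists x.
- by move=> c x y [[Dx _] px] [[Dy _] py]; apply: gl.
have [|||H Hl eH] := J0 X D (q \o p) Ds qpl _ _ G.
- by move=> x Dx; apply/IJ/DI.
- by move=> v /JI[u /ID[x Dx <-] <-]; exists x.
- exact: Gl.
have pq x : p x = 0 -> (q \o p) x = 0 by rewrite /= => ->; apply: lin_on0 ql.
by exists H => // x [Dx px]; rewrite eH ?eG //; do ?split=> //; apply: pq.
Qed.

(** Vanishing passes to a direct summand: the sequence is pulled back along the retraction [r], the
    map is extended there and restricted along [i]. *)
Lemma Ext1_zero_retract U V (I : U -> Prop) (J : V -> Prop) (i : V -> U) (r : U -> V) :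
  submod I -> submod J -> lin_on I r -> lin_on J i -> (forall v, J v -> I (i v)) ->
  (forall u, I u -> J (r u)) -> (forall v, J v -> r (i v) = v) ->
  Ext1_zero I -> Ext1_zero J.
Proof.
move=> Is Js rl il JI IJ ri I0 X D p Ds pl DJ JD g gl.
pose D' (z : X * U) := [/\ D z.1, I z.2 & p z.1 = r z.2].
have D's : submod D'.
  split.
    have [[D0 _] [J0 _]] := (Ds, Is).
    by split; rewrite //= (lin_on0 Ds pl) (lin_on0 Is rl).
  move=> c [x u] [y v] [/= Dx Iu e] [/= Dy Iv e']; split=> /=.
  - exact: Ds.2.
  - exact: Is.2.
  - by rewrite pl // rl // e e'.
have [||||G Gl eG] := I0 _ D' (fun z => z.2) D's _ _ _ (fun z => g z.1).
- by [].
- by move=> z [].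
- by move=> u Iu; have [x Dx px] := JD (r u) (IJ u Iu); exists (x, u).
- move=> c [x u] [y v] [[/= Dx Iu e] u0] [[/= Dy Iv e'] v0]; apply: gl.
    by rewrite e u0 (lin_on0 Is rl).
  by rewrite e' v0 (lin_on0 Is rl).
exists (fun x => G (x, i (p x))) => [c x y Dx Dy|x [Dx px]].
  rewrite pl // il; [|exact: DJ|exact: DJ].
  have -> : (c *: x + y, c *: i (p x) + i (p y)) = c *: (x, i (p x)) + (y, i (p y)) by [].
  apply: Gl.
    by split=> //=; [apply/JI/DJ | rewrite ri //; apply: DJ].
  by split=> //=; [apply/JI/DJ | rewrite ri //; apply: DJ].
rewrite eG //; do 2?split=> //=; rewrite px (lin_on0 Js il) ?(lin_on0 Is rl) //.
by case: Is.
Qed.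

Lemma Ext1_zero_free : Ext1_zero (fun _ : R^o => True).
Proof.
move=> X D p Ds pl _ onto g gl.
have [x1 Dx1 px1] := onto 1 I.
have Dk x : D x -> D (x - p x *: x1) /\ p (x - p x *: x1) = 0.
  move=> Dx; have Dpx := submodZ Ds (p x) Dx1.
  split; first exact: submodB.
  by rewrite (lin_onB pl) // (lin_onZ Ds pl) // px1 /GRing.scale /= mulr1 subrr.
exists (fun x => g (x - p x *: x1)) => [c x y Dx Dy|x [Dx px]].
  rewrite -gl; [congr g|exact: Dk|exact: Dk].
  by rewrite pl // scalerBr scalerDl scalerA opprD addrACA.
by rewrite px scale0r subr0.
Qed.

Lemma cover_lift V M (I : V -> Prop) (p : V -> M) : submod I -> lin_on I p ->
  (forall u, exists2 v, I v & p v = u) ->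
  exists s : {linear {freeg M / R} -> V},
    forall f, I (s f) /\ p (s f) = free_cover M f.
Proof.
move=> Is pl onto; have /choice[s sP] u : exists v, I v /\ p v = u.
  by have [v ? ?] := onto u; exists v.
exists (fglift s) => f.
have [|If ->] := fglift_comp f Is pl (f := s); first by move=> u; case: (sP u).
split=> //; congr (fglift _ f); apply: funext => u; exact: (sP u).2.
Qed.

(** The sequence of the free cover is universal: it maps by [s] to any sequence ending in [M], and
    [x - s <<p x>>] lies in the kernel of [p]. *)
Lemma Ext1_zero_of_cover M :
  extendable (fun _ : {freeg M / R} => True) (fun z => free_cover M z = 0) ->
  Ext1_zero (fun _ : M => True).
Proof.
move=> ext X D p Ds pl _ onto g gl.
have [|s sP] := cover_lift Ds pl; first by move=> u; apply: onto.
have kers f : free_cover M f = 0 -> D (s f) /\ p (s f) = 0.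
  by move=> f0; have [Dsf ->] := sP f.
have [|G Gl eG] := ext (fun f => g (s f)).
  by move=> c f h f0 h0; rewrite linearP gl //; apply: kers.
pose rho x := x - s <<p x>>.
have rhoK x : D x -> D (rho x) /\ p (rho x) = 0.
  move=> Dx; have [Ds' ps] := sP <<p x>>; split; first exact: submodB.
  by rewrite (lin_onB pl) // ps coverU subrr.
have Ks := submod_ker Ds pl.
exists (fun x => G <<p x>> + g (rho x)) => [c x y Dx Dy|x [Dx px]].
  (* The map [x |-> <<p x>>] is not linear; its defect [f] is a syzygy, on which [G f = g (s f)]
     makes the two summands compensate. *)
  pose f := c *: <<p x>> + <<p y>> - <<p (c *: x + y)>> : {freeg M / R}.
  have f0 : free_cover M f = 0 by rewrite /f linearB linearP !coverU pl // subrr.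
  have -> : rho (c *: x + y) = (c *: rho x + rho y) + s f.
    rewrite /rho /f scalerBr (linearB s) (linearP s) [_ + (y - _)]addrACA -opprD.
    by rewrite addrA subrK.
  have [Kx Ky] := (rhoK x Dx, rhoK y Dy).
  rewrite (lin_onD gl) ?gl //; [|exact: Ks.2|exact: kers].
  rewrite -eG // (lin_onB Gl) // Gl // addrC -addrA subrK addrC.
  by rewrite scalerDr [RHS]addrACA.
have f0 : free_cover M <<p x>> = 0 by rewrite coverU.
rewrite eG // /rho (lin_onB gl) //; last exact: kers.
by rewrite addrC subrK.
Qed.

Lemma Ext1_zero_of_Ext M j : (forall c : Ext j.+1 M W, c = 0) ->
  Ext1_zero (fun _ : syz M j => True).
Proof.
move=> E0; apply: Ext1_zero_of_cover => g gl.
have [ext _] := Ext_annP 1 M W j; have [|G eG] := ext _ g gl.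
  by move=> c; rewrite (E0 c) scaler0.
by exists G => [|z z0]; [exact: lin_on_linear | rewrite eG // scale1r].
Qed.

Lemma Ext1_zero_ker_cover M : (forall c : Ext 2 M W, c = 0) ->
  Ext1_zero (fun z : {freeg M / R} => free_cover M z = 0).
Proof.
move=> /Ext1_zero_of_Ext; pose cls z : syz M 1 := insubd (0 : syz M 1) z.
have clsE z : free_cover M z = 0 -> \val (cls z) = z.
  by move=> z0; rewrite insubdK //; apply/eqP.
have Ks := submod_ker_linear (free_cover M).
apply: (Ext1_zero_iso (q := cls) Ks) => //.
- move=> c y z y0 z0; apply: val_inj.
  apply: (etrans (clsE _ (Ks.2 c _ _ y0 z0))).
  by change (c *: y + z = c *: \val (cls y) + \val (cls z)); rewrite !clsE.
- move=> z _; exists (\val z); first exact: cover_ker.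
  by apply: val_inj; rewrite clsE // cover_ker.
- by move=> z z0 e; rewrite -(clsE z z0) e.
Qed.

Section Pullback.
Context (V M : lmodType R) (I : V -> Prop) (p : V -> M).
Hypotheses (Is : submod I) (pl : lin_on I p)
  (onto : forall u, exists2 v, I v & p v = u).

(** The fibre product of [I] and the free module over [M]. *)
Let P (z : V * {freeg M / R}) := I z.1 /\ p z.1 = free_cover M z.2.

Let Ps : submod P.
Proof.
split=> [|c [v f] [v' f'] [/= Iv e] [/= Iv' e']].
  by split; [exact: Is.1 | rewrite /= linear0 (lin_on0 Is pl)].
by split; [exact: Is.2 | rewrite /= pl // linearP e e'].
Qed.

Let fst_onto v : I v -> exists2 z, P z & z.1 = v.
Proof. by move=> Iv; exists (v, <<p v>>) => //; split=> //=; rewrite coverU. Qed.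

(** The fibre product [P] is an extension of [I] by the syzygies of [M], so its first Ext vanishes;
    its projection to the free module splits, which makes the kernel of [p] a direct summand of
    [P]. *)
Lemma Ext1_zero_ker : Ext1_zero (fun z : {freeg M / R} => free_cover M z = 0) ->
  Ext1_zero I -> Ext1_zero (fun v => I v /\ p v = 0).
Proof.
move=> K0 I0; have P0 : Ext1_zero P.
  apply: (Ext1_zero_extension (q := fst) Ps) I0 => //; first by move=> z [].
  apply: (Ext1_zero_iso (q := snd)) K0 => //.
  - exact: submod_ker Ps _.
  - by move=> z [[_ e] z1]; rewrite -e z1 (lin_on0 Is pl).
  - move=> f f0; exists (0, f) => //; split=> //; split; first exact: Is.1.
    by rewrite /= f0 (lin_on0 Is pl).
  - by move=> [v f] [_ /= ->] /= ->.
have [s sP] := cover_lift Is pl onto.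
apply: (Ext1_zero_retract (i := fun v => (v, 0)) (r := fun z => z.1 - s z.2) Ps) P0.
- exact: submod_ker.
- by move=> c [v f] [v' f'] _ _ /=; rewrite linearP scalerBr opprD addrACA.
- by move=> c v v' _ _; congr (_, _); rewrite /= ?scaler0 addr0.
- by move=> v [Iv pv]; split; rewrite //= pv linear0.
- move=> [v f] [/= Iv e]; have [Isf es] := sP f; split; first exact: submodB.
  by rewrite (lin_onB pl) // e es subrr.
- by move=> v _; rewrite /= linear0 subr0.
Qed.

(** The map [g] extends to [G] on the fibre product, and [G] on the kernel of [p] extends to [h] on
    [I]; the difference vanishes on that kernel and descends to the free module through [s]. *)
Lemma extendable_cover : Ext1_zero I -> extendable I (fun v => I v /\ p v = 0) ->
  extendable (fun _ => True) (fun z : {freeg M / R} => free_cover M z = 0).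
Proof.
move=> I0 ext g gl; have [|z []||G Gl eG] := I0 _ P fst Ps _ _ fst_onto (fun z => g z.2) => //.
  move=> c [v f] [v' f'] [[/= _ e] v0] [[/= _ e'] v'0]; apply: gl => /=.
    by rewrite -e v0 (lin_on0 Is pl).
  by rewrite -e' v'0 (lin_on0 Is pl).
have Pv v : I v /\ p v = 0 -> P (v, 0) by case=> Iv pv; split; rewrite //= pv linear0.
have [|h hl eh] := ext (fun v => G (v, 0)).
  move=> c v v' Kv Kv'; rewrite -Gl; try exact: Pv.
  by congr (G (_, _)); rewrite /= ?scaler0 addr0.
have [s sP] := cover_lift Is pl onto.
have Psf f : P (s f, f) by have [] := sP f.
exists (fun f => G (s f, f) - h (s f)) => [c f f' _ _|f f0].
  have [[Isf _] [Isf' _]] := (sP f, sP f').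
  have -> : (s (c *: f + f'), c *: f + f') = c *: (s f, f) + (s f', f').
    by rewrite linearP.
  by rewrite Gl // linearP hl // scalerBr opprD addrACA.
have [Isf psf] := sP f; rewrite f0 in psf.
have P0f : P (0, f) by split; [exact: Is.1 | rewrite /= f0 (lin_on0 Is pl)].
rewrite eh // -(lin_onB Gl) //; last exact: Pv.
have -> : (s f, f) - (s f, 0) = (0, f) by congr (_, _); rewrite /= ?subrr ?subr0.
by rewrite eG //; split.
Qed.

End Pullback.

(* [phi] represents a linear map from [I] to [W / t W]. *)
Lemma lift_mod V (I : V -> Prop) (t : R) (phi : V -> W) :
  submod I -> Ext1_zero I -> (forall w : W, t *: w = 0 -> w = 0) ->
  (forall c u v, I u -> I v -> exists w,
    phi (c *: u + v) - (c *: phi u + phi v) = t *: w) ->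
  exists2 Q, lin_on I Q & forall u, I u -> exists w, Q u - phi u = t *: w.
Proof.
move=> Is I0 treg phil.
have phi0 : exists w, phi 0 = t *: w.
  have [w /= e] := phil (-1) _ _ Is.1 Is.1; exists w.
  by rewrite -e scaler0 addr0 scaleN1r addNr subr0.
pose D (z : V * W) := I z.1 /\ exists w, z.2 - phi z.1 = t *: w.
have Ds : submod D.
  split=> [|c [v y] [v' y'] [/= Iv [w e]] [/= Iv' [w' e']]].
    split; first exact: Is.1.
    by have [w /= ->] := phi0; exists (- w); rewrite sub0r scalerN.
  split; first exact: Is.2.
  have [w'' e''] := phil c _ _ Iv Iv'; exists (c *: w + w' - w'').
  rewrite /= scalerBr scalerDr scalerA mulrC -scalerA -e -e' -e'' opprB.
  rewrite scalerBr (addrACA (c *: y)) -opprD addrA subrK.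
  by [].
have [dv dvP] : exists dv : W -> W, forall w, dv (t *: w) = w.
  exists (fun y => if pselect (exists w, y = t *: w) is left e then sval (cid e) else 0).
  move=> w; case: pselect => [e|[]]; last by exists w.
  case: cid => w' /= /eqP; rewrite -subr_eq0 -scalerBr => /eqP /treg /eqP.
  by rewrite subr_eq0 => /eqP.
have Kt v y : D (v, y) /\ v = 0 -> exists w, y = t *: w.
  move=> [[/= _ [w e]] v0]; rewrite v0 in e; have [w' e'] := phi0.
  by exists (w + w'); rewrite scalerDr -e -e' subrK.
have [||v Iv||G Gl eG] := I0 _ D fst Ds _ _ _ (fun z => dv z.2).
- by [].
- by move=> z [].
- by exists (v, phi v) => //; split=> //; exists 0; rewrite subrr scaler0.
- move=> c [v y] [v' y'] /Kt[w /= ->] /Kt[w' /= ->].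
  by rewrite scalerA mulrC -scalerA -scalerDr !dvP.
have Dphi v : I v -> D (v, phi v) by split=> //; exists 0; rewrite subrr scaler0.
exists (fun u => phi u - t *: G (u, phi u)) => [c u v Iu Iv|u Iu]; last first.
  by exists (- G (u, phi u)); rewrite addrC addKr scalerN.
have [w e] := phil c _ _ Iu Iv; have Iuv := Is.2 c _ _ Iu Iv.
have -> : G (c *: u + v, phi (c *: u + v)) = c *: G (u, phi u) + G (v, phi v) + w.
  have De : (c *: u + v, phi (c *: u + v)) - (c *: (u, phi u) + (v, phi v)) = (0, t *: w).
    by rewrite -e; congr (_, _); rewrite /= subrr.
  rewrite -Gl; try exact: Dphi.
  have <- : G (c *: u + v, phi (c *: u + v)) - G (c *: (u, phi u) + (v, phi v)) = w.
    have [w' e'] := phi0.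
    rewrite -(lin_onB Gl); [|exact: Dphi|by apply: Ds.2; apply: Dphi].
    rewrite De eG /= ?dvP //; split=> //; split; first exact: Is.1.
    by exists (w - w'); rewrite /= scalerBr -e'.
  by rewrite [RHS]addrC subrK.
move/eqP: e; rewrite subr_eq => /eqP ->.
rewrite [t *: w + _]addrC scalerDr opprD addrACA subrr addr0.
by rewrite scalerDr opprD addrACA scalerBr !scalerA mulrC.
Qed.

End Ext1Vanishing.

(** * Coefficients in semigroup rings *)

Section Coefficients.
Context (v : version) (k : fieldType) (a : seq nat).
Local Notation R := (nsring v k a).
Local Notation S := (semigroup a).
Implicit Types (u r : R) (P Q : nat -> Prop) (c : k) (h s : nat).

Definition scoef : R -> nat -> k :=
  match v return nsring v k a -> nat -> k with
  | Graded => fun p h => (\val p)`_h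
  | Complete => fun f => \val f
  end.

Lemma scoef_inj u r : (forall h, scoef u h = scoef r h) -> u = r.
Proof.
rewrite /scoef; case: v u r => u r e; apply: val_inj; first exact/polyP.
exact: funext.
Qed.

Lemma scoef_supp u h : scoef u h != 0 -> S h.
Proof. by rewrite /scoef; case: v u => -[p pS] /=; move/asboolP: pS; apply. Qed.

Lemma scoef0 h : scoef 0 h = 0.
Proof. by rewrite /scoef; case: v => //=; rewrite coef0. Qed.

Lemma scoef1 h : scoef 1 h = (h == 0%N)%:R.
Proof. by rewrite /scoef; case: v => //=; rewrite coef1. Qed.

Lemma scoefD u r h : scoef (u + r) h = scoef u h + scoef r h.
Proof. by rewrite /scoef; case: v u r => u r //=; rewrite coefD. Qed.

Lemma scoefN u h : scoef (- u) h = - scoef u h.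
Proof. by rewrite /scoef; case: v u => u //=; rewrite coefN. Qed.

Lemma scoefB u r h : scoef (u - r) h = scoef u h - scoef r h.
Proof. by rewrite scoefD scoefN. Qed.

Lemma scoefM u r h : scoef (u * r) h = \sum_(i < h.+1) scoef u i * scoef r (h - i)%N.
Proof. by rewrite /scoef; case: v u r => u r //=; rewrite coefM. Qed.

Lemma scoef_sum (I : Type) (l : seq I) (F : I -> R) h :
  scoef (\sum_(i <- l) F i) h = \sum_(i <- l) scoef (F i) h.
Proof.
by elim: l => [|i l IHl]; rewrite ?(big_nil, big_cons) ?scoef0 // scoefD IHl.
Qed.

Lemma scoef_of_graded (p : sg_poly k a) h : scoef (of_graded v p) h = (\val p)`_h.
Proof. by rewrite /scoef /of_graded; case: v. Qed.

Lemma scoefM_neq0 u r h : scoef (u * r) h != 0 ->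
  exists i j, [/\ h = (i + j)%N, scoef u i != 0 & scoef r j != 0].
Proof.
rewrite scoefM => nz; apply: contrapT => no.
case/eqP: nz; apply: big1 => i _; apply/eqP; rewrite mulf_eq0.
apply: contraT; rewrite negb_or => /andP[ui rj]; case: no.
by exists i, (h - i)%N; rewrite subnKC // -ltnS.
Qed.

Lemma scoef_bounded u : v = Graded -> exists B, forall h, (B <= h)%N -> scoef u h = 0.
Proof.
rewrite /scoef; case: v u => // u _.
by exists (size (\val u)) => h; apply: nth_default.
Qed.

Lemma scoef_surj (F : nat -> k) : (forall h, F h != 0 -> S h) ->
  (v = Graded -> exists B, forall h, (B <= h)%N -> F h = 0) ->
  exists u, forall h, scoef u h = F h.
Proof.
rewrite /scoef => FS; case: v => [[//|B FB]|_].
- have pin : \poly_(i < B) F i \in @sg_poly_pred k a.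
    apply/asboolP => h; rewrite coef_poly; case: ifP => _; [exact: FS | by rewrite eqxx].
  by exists (SgPoly pin) => h /=; rewrite coef_poly; case: ltnP => // /FB.
- have fin : F \in @sg_fps_pred k a by apply/asboolP.
  by exists (SgFps fin).
Qed.

(** Division by [t^d], exact when every exponent of [u] lies in [d + P]. *)
Lemma shift_exists u (d : nat) P : (forall s, P s -> S s) ->
  exists r, forall s, scoef r s = if `[< P s >] then scoef u (s + d)%N else 0.
Proof.
move=> PS; pose F s := if `[< P s >] then scoef u (s + d)%N else 0.
apply: (@scoef_surj F).
  by rewrite /F => s; case: asboolP => [/PS //|_]; rewrite eqxx.
move=> /(scoef_bounded u)[B uB]; exists B => h le_Bh; rewrite /F.
by case: asboolP => // _; rewrite uB // (leq_trans le_Bh) ?leq_addr.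
Qed.

Definition mono c h : R := of_graded v (insubd (0 : sg_poly k a) (c *: 'X^h)).

Lemma scoef_mono c h s : S h -> scoef (mono c h) s = if s == h then c else 0.
Proof.
move=> hS; rewrite scoef_of_graded insubdK ?coefZ ?coefXn.
  by case: (s == h); rewrite ?mulr1 ?mulr0.
apply/asboolP => i; rewrite coefZ coefXn.
by case: (i =P h) => [-> //|_]; rewrite mulr0 eqxx.
Qed.

Lemma tpowE h : of_graded v (tpow h) = mono 1 h.
Proof. by rewrite /mono scale1r. Qed.

Lemma scoefMmono c h u s : S h ->
  scoef (mono c h * u) s = if (h <= s)%N then c * scoef u (s - h)%N else 0.
Proof.
move=> hS; rewrite scoefM; under eq_bigr => i _ do rewrite scoef_mono //.
case: leqP => [le_hs|lt_sh].
  rewrite (bigD1 (Ordinal (le_hs : (h < s.+1)%N))) //= eqxx big1 ?addr0 // => i.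
  by rewrite -val_eqE /= => /negbTE ->; rewrite mul0r.
rewrite big1 // => i _; case: eqP => [e|_]; last by rewrite mul0r.
by have := ltn_ord i; rewrite e ltnS leqNgt lt_sh.
Qed.

Lemma scoefMmonoD c h u s : S h -> scoef (mono c h * u) (h + s) = c * scoef u s.
Proof. by move=> hS; rewrite scoefMmono // leq_addr addKn. Qed.

Lemma mono0 h : S h -> mono 0 h = 0.
Proof. by move=> hS; apply: scoef_inj => s; rewrite scoef_mono // scoef0 if_same. Qed.

Lemma monoM c c' h h' : S h -> S h' -> mono c h * mono c' h' = mono (c * c') (h + h').
Proof.
move=> hS hS'; apply: scoef_inj => s; rewrite scoefMmono //.
rewrite !scoef_mono //; last exact: semigroupD.
case: leqP => [le_hs|lt_sh].
  by rewrite -(eqn_add2l h) subnKC //; case: eqP; rewrite ?mulr0.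
by case: eqP => // e; rewrite e ltnNge leq_addr in lt_sh.
Qed.

Lemma monoD c c' h : S h -> mono (c + c') h = mono c h + mono c' h.
Proof.
by move=> hS; apply: scoef_inj => s; rewrite scoefD !scoef_mono //; case: eqP; rewrite ?addr0.
Qed.

Lemma mono1 : mono 1 0 = 1.
Proof.
apply: scoef_inj => s; rewrite scoef_mono; last exact: semigroup0.
by rewrite scoef1; case: eqP.
Qed.

Lemma monoK c h : c != 0 -> S h -> mono c^-1 0 * mono c h = mono 1 h.
Proof. by move=> c0 hS; rewrite monoM ?mulVf //; apply: semigroup0. Qed.

Definition supp_in P u := forall h, scoef u h != 0 -> P h.

Definition sclosed P := forall s h, S s -> P h -> P (s + h)%N.

Lemma supp_inB P u r : supp_in P u -> supp_in P r -> supp_in P (u - r).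
Proof.
move=> Pu Pr h; rewrite scoefB; have [-> |/Pu //] := eqVneq (scoef u h) 0.
by rewrite sub0r oppr_eq0 => /Pr.
Qed.

Lemma supp_inD P u r : supp_in P u -> supp_in P r -> supp_in P (u + r).
Proof.
move=> Pu Pr h; rewrite scoefD; have [-> |/Pu //] := eqVneq (scoef u h) 0.
by rewrite add0r => /Pr.
Qed.

Lemma supp_inM P u r : sclosed P -> supp_in P u -> supp_in P (r * u).
Proof.
move=> Pc Pu h /scoefM_neq0[i [j [-> ri uj]]].
exact: Pc (scoef_supp ri) (Pu _ uj).
Qed.

Lemma submod_supp P : sclosed P -> submod (V := R^o) (supp_in P).
Proof.
move=> Pc; split=> [h|c u r Pu Pr]; first by rewrite scoef0 eqxx.
by apply: supp_inD => //; apply: supp_inM.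
Qed.

Lemma supp_mono P c h : S h -> P h -> supp_in P (mono c h).
Proof. by move=> hS Ph s; rewrite scoef_mono //; case: (s =P h) => [->|] //; rewrite eqxx. Qed.

Definition hull n (d : 'I_n -> nat) (h : nat) := exists i s, S s /\ h = (d i + s)%N.

Lemma sclosed_hull n (d : 'I_n -> nat) : sclosed (hull d).
Proof.
move=> s _ sS [i [s' [s'S ->]]]; exists i, (s + s')%N; split; first exact: semigroupD.
by rewrite addnCA.
Qed.

(** Even a series with infinite support is a finite combination: for each generator in turn, the
    part of the support in [d i + S] is divided by [t^(d i)] and removed. *)
Lemma gen_hull n (c : 'I_n -> k) (d : 'I_n -> nat) (u : R) :
  (forall i, c i != 0) -> (forall i, S (d i)) ->
  u \in gen (fun i => mono (c i) (d i) : R^o) <-> supp_in (hull d) u.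
Proof.
move=> c0 dS; split.
  apply: submod_span_ind; first exact/submod_supp/sclosed_hull.
  move=> _ [i ->]; apply: supp_mono => //; exists i, 0%N.
  by rewrite addn0; split=> //; apply: semigroup0.
set I := gen _.
have monoI i r : r * mono 1 (d i) \in I.
  rewrite -(monoK (c0 i) (dS i)) mulrA.
  have mI : (mono (c i) (d i) : R^o) \in I by apply: submod_span_mem; exists i.
  exact: (submodZ (submod_in I) _ mI).
suff H (l : seq 'I_n) w : supp_in (fun h => exists2 i, i \in l &
    exists2 s, S s & h = (d i + s)%N) w -> w \in I.
  move=> uE; apply: (H (enum 'I_n)) => h /uE[i [s [sS e]]].
  by exists i; rewrite ?mem_enum //; exists s.
elim: l w => [|i l IHl] w wl.
  suff -> : w = 0 by apply: (submod_in I).1.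
  apply: scoef_inj => h; rewrite scoef0; apply/eqP/contraT => /wl[j].
  by rewrite in_nil.
have [r rE] := @shift_exists w (d i) S (fun _ => id).
rewrite -(subrK (r * mono 1 (d i)) w); apply: (submodD (submod_in I)) => //.
apply: IHl => h; rewrite scoefB mulrC scoefMmono // mul1r => nz.
have [le_dh|lt_hd] := leqP (d i) h.
  rewrite le_dh rE subnK // in nz.
  case: asboolP nz => [_|nS nz]; first by rewrite subrr eqxx.
  have := nz; rewrite subr0 => /wl[j].
  rewrite inE => /orP[/eqP ->|jl] [s sS e]; last by exists j => //; exists s.
  by case: nS; rewrite e addKn.
move: nz; rewrite leqNgt lt_hd /= subr0 => /wl[j].
rewrite inE => /orP[/eqP ->|jl] [s sS e]; last by exists j => //; exists s.
by rewrite e ltnNge leq_addr in lt_hd.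
Qed.

End Coefficients.

(** * Semigroups of minimal multiplicity *)

Section Semigroup.
Context (a : seq nat).
Hypotheses (a_pos : forall h, h \in a -> (0 < h)%N) (a_increasing : sorted ltn a)
  (a_neq0 : a != [::]).
Local Notation S := (semigroup a).
Local Notation e := (multiplicity a).

Definition posS h := S h /\ h <> 0%N.

Lemma semigroup_mem h : h \in a -> S h.
Proof.
move=> ha; have lt_i : (index h a < size a)%N by rewrite index_mem.
exists (fun i => nat_of_bool (i == Ordinal lt_i)).
rewrite (bigD1 (Ordinal lt_i)) //= eqxx mul1n nth_index // big1 ?addn0 // => i.
by move=> /negbTE ->.
Qed.

Lemma multiplicity_in : e \in a.
Proof. by case: a a_neq0 => //= h l _; rewrite mem_head. Qed.

Lemma multiplicity_gt0 : (0 < e)%N. Proof. exact/a_pos/multiplicity_in. Qed.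

Lemma multiplicity_min h : h \in a -> (e <= h)%N.
Proof.
rewrite /multiplicity; case: a a_increasing a_neq0 => //= h0 l + _.
rewrite path_sortedE; last exact: ltn_trans.
by move=> /andP[/allP h0l _]; rewrite inE => /predU1P[->|/h0l/ltnW].
Qed.

Lemma semigroup_split h : S h -> h <> 0%N ->
  exists2 b, b \in a & exists2 s, S s & h = (b + s)%N.
Proof.
move=> [c ->] /eqP; rewrite sum_nat_eq0 negb_forall => /existsP[i].
rewrite negb_imply /= muln_eq0 negb_or -lt0n => /andP[ci _].
exists (nth 0 a i)%N; first exact: mem_nth.
exists (\sum_j (if j == i then (c j).-1 else c j) * nth 0 a j)%N; first by eexists.
rewrite (bigD1 i) // [in RHS](bigD1 i) //= eqxx addnA -mulSn prednK //; congr addn.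
by apply: eq_bigr => j /negbTE ->.
Qed.

Lemma posS_multiplicity : posS e.
Proof.
by split; [exact/semigroup_mem/multiplicity_in | apply/eqP; rewrite -lt0n multiplicity_gt0].
Qed.

Lemma posS_ge h : posS h -> (e <= h)%N.
Proof.
case=> hS h0; have [b ba [s _ ->]] := semigroup_split hS h0.
by rewrite (leq_trans (multiplicity_min ba)) ?leq_addr.
Qed.

Lemma posSD s h : S s -> posS h -> posS (s + h).
Proof.
move=> sS [hS h0]; split; first exact: semigroupD.
by move/eqP; rewrite addn_eq0 => /andP[_ /eqP].
Qed.

Lemma semigroupM q : S (q * e).
Proof.
elim: q => [|q IHq]; first exact: semigroup0.
by rewrite mulSn; apply: semigroupD => //; case: posS_multiplicity.
Qed.

(* The complement of [h + S] in [S] consists of the least elements of the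
   residue classes modulo [h]. *)
Lemma finite_colength h : (0 < h)%N -> S h ->
  exists B, forall s, S s -> (B <= s)%N -> exists2 t, S t & s = (h + t)%N.
Proof.
move=> h0 hS; have /choice[B BP] (i : 'I_h) : exists B, forall s, S s -> (B <= s)%N ->
    (s %% h)%N = i -> exists2 t, S t & s = (h + t)%N.
  have [[m mP]|no] := pselect (exists m, S m /\ (m %% h)%N = i); last first.
    by exists 0%N => s sS _ si; case: no; exists s.
  have [mS mi] := mP; exists (m + h)%N => s sS le_ms si.
  exists (s - h)%N; last by rewrite subnKC // (leq_trans _ le_ms) ?leq_addl.
  have : (s - h = m %[mod h])%N.
    by rewrite mi -si -[in RHS](@subnKC h s) ?modnDl // (leq_trans _ le_ms) ?leq_addl.
  have le_m : (m <= s - h)%N by rewrite leq_subRL ?(leq_trans _ le_ms) ?leq_addl // addnC.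
  move/eqP; rewrite eqn_mod_dvd // => /dvdnP[q eq].
  rewrite -(subnKC le_m) eq; apply: semigroupD => //.
  by elim: q {eq} => [|q IHq]; [exact: semigroup0 | rewrite mulSn; apply: semigroupD].
exists (\max_i B i)%N => s sS le_Bs.
have lt_sh : (s %% h < h)%N by rewrite ltn_mod.
apply: (BP (Ordinal lt_sh)) => //; apply: leq_trans le_Bs.
exact: leq_bigmax.
Qed.

Section MaximalIdeal.
Context (v : version) (k : fieldType).

Lemma sclosed_posS : sclosed a posS. Proof. exact: posSD. Qed.

Lemma max_idealE u : u \in max_ideal v k a <-> supp_in posS u.
Proof.
split.
  apply: submod_span_ind; first exact/submod_supp/sclosed_posS.
  move=> _ [h ha ->]; rewrite tpowE; apply: supp_mono; first exact: semigroup_mem.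
  by split; [exact: semigroup_mem | apply/eqP; rewrite -lt0n a_pos].
move=> up; have : supp_in (hull a (fun i : 'I_(size a) => nth 0 a i)%N) u.
  move=> h /up[hS h0]; have [b ba [s sS ->]] := semigroup_split hS h0.
  have lt_i : (index b a < size a)%N by rewrite index_mem.
  by exists (Ordinal lt_i), s; rewrite /= nth_index.
have aS (i : 'I_(size a)) : S (nth 0 a i)%N by apply/semigroup_mem/mem_nth.
move=> /(gen_hull (v := v) _ (c := fun=> 1) (fun=> oner_neq0 k) aS).2.
apply: (submod_span_ind (submod_in (max_ideal v k a))).
move=> _ [i ->]; apply: submod_span_mem; exists (nth 0 a i)%N; first exact: mem_nth.
by rewrite tpowE.
Qed.

(* If [s + t - e] is not in [S], then [m] is generated by the [e - 1] monomials
   [t^d] with [d] least in a residue class modulo [e] other than that of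
   [s + t]. *)
Lemma minimal_multiplicityP : minimal_multiplicity v k a ->
  forall s t, posS s -> posS t -> exists2 r, S r & (s + t = e + r)%N.
Proof.
move=> [_ mu_min] s t sP tP; apply: contrapT => no.
have noS r : S r -> (s + t)%N <> (e + r)%N by move=> rS er; case: no; exists r.
have e0 := multiplicity_gt0; have e1 : e.-1.+1 = e by rewrite prednK.
pose W := (s + t)%N; pose i0 := (W %% e)%N.
have lt_i0 : (i0 < e.-1.+1)%N by rewrite e1 ltn_mod.
(* [bump i0] enumerates the residues modulo [e] other than [i0]; a class without positive element
   gets the harmless value [e]. *)
have /choice[d dP] (i : 'I_e.-1) : exists d, posS d /\
    forall h, posS h -> (h %% e)%N = bump i0 i -> exists2 q, S q & h = (d + q)%N.
  pose Q m := `[< posS m /\ (m %% e)%N = bump i0 i >].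
  have [exQ|none] := pselect (exists m, Q m).
    have [m /asboolP[mP mi] mmin] := ex_minnP exQ.
    exists m; split=> // h hP hi.
    have le_mh : (m <= h)%N by apply: mmin; apply/asboolP.
    exists (h - m)%N; last by rewrite subnKC.
    have : (h == m %[mod e])%N by rewrite hi mi.
    by rewrite eqn_mod_dvd // => /dvdnP[q ->]; apply: semigroupM.
  exists e; split; first exact: posS_multiplicity.
  by move=> h hP hi; case: none; exists h; apply/asboolP.
suff gE : gen (fun i => mono v a 1 (d i) : (nsring v k a)^o) =i max_ideal v k a.
  by have := mu_min _ _ gE; rewrite -ltnS e1 ltnn.
have dS i : S (d i) by case: (dP i) => -[].
suff hullE h : hull a d h <-> posS h.
  move=> u; apply/idP/idP => [|/max_idealE uP].
    move/(gen_hull (v := v) _ (c := fun=> 1) (fun=> oner_neq0 k) dS).1 => uP.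
    by apply/max_idealE => h /uP/hullE.
  apply/(gen_hull (v := v) _ (c := fun=> 1) (fun=> oner_neq0 k) dS).
  by move=> h /uP /hullE.
split=> [[i [q [qS ->]]]|hP]; first by rewrite addnC; apply: posSD => //; case: (dP i).
have outside g : posS g -> (g %% e)%N != i0 -> hull a d g.
  move=> gP gi; have lt_g : (g %% e < e.-1.+1)%N by rewrite e1 ltn_mod.
  have := unlift_some (_ : Ordinal lt_i0 != Ordinal lt_g).
  rewrite -val_eqE eq_sym /= => /(_ gi)[j /(congr1 val) /= ej _].
  by have [_ /(_ g gP ej)[q qS ->]] := dP j; exists j, q.
have [hi|/(outside _ hP) //] := eqVneq (h %% e)%N i0.
(* As [W - e] is not in the semigroup, no smaller element of the semigroup shares the residue class
   of [W]. *)
have below g : S g -> (g <= W)%N -> (g %% e)%N = i0 -> g = W.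
  move=> gS le_gW gi; apply/eqP; rewrite eqn_leq le_gW /= leqNgt; apply/negP => lt_gW.
  have : (W == g %[mod e])%N by rewrite gi.
  rewrite eqn_mod_dvd // => /dvdnP[[|q] eq].
    by move: lt_gW; rewrite -subn_gt0 eq mul0n.
  apply: (noS (g + q * e)%N); first by apply: semigroupD => //; apply: semigroupM.
  by rewrite -/W -(subnKC le_gW) eq mulSn addnCA.
have lt_sW : (s < W)%N by rewrite -addn1 leq_add2l; case: tP => _ /eqP; rewrite -lt0n.
have si : (s %% e)%N != i0.
  by apply/eqP => si; move: (lt_sW); rewrite [s in (s < _)%N](below s sP.1 (ltnW lt_sW) si) ltnn.
have le_Wh : (W <= h)%N.
  rewrite leqNgt; apply/negP => lt_hW; move: (lt_hW).
  by rewrite [h in (h < _)%N](below h hP.1 (ltnW lt_hW) hi) ltnn.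
have : (h == W %[mod e])%N by rewrite hi.
rewrite eqn_mod_dvd // => /dvdnP[q eq].
rewrite -(subnKC le_Wh) eq /W -addnA.
(* Here [h = s + t + q * e], and [s] is in the hull because it avoids the class of [W]. *)
have [i [r [rS ->]]] := outside _ sP si.
exists i, (r + (t + q * e))%N; split; last by rewrite [RHS]addnA.
exact: semigroupD rS (semigroupD tP.1 (semigroupM q)).
Qed.

End MaximalIdeal.
End Semigroup.

(** * The canonical module *)

Section CanonicalModule.
Context (v : version) (k : fieldType) (a : seq nat).
Hypotheses (a_pos : forall h, h \in a -> (0 < h)%N) (a_increasing : sorted ltn a)
  (a_neq0 : a != [::]).
Local Notation R := (nsring v k a).
Local Notation S := (semigroup a).
Local Notation posS := (posS a).
Local Notation e := (multiplicity a).
Local Notation mono := (mono v a).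
Local Notation m := (max_ideal v k a).
Local Notation T h := (mono 1 h : R).
Local Notation k0 := (residue_field v k a).

Let S0 : S 0 := semigroup0 a.

Let max_idealP (u : R) : (u \in m) <-> supp_in posS u.
Proof. exact: max_idealE. Qed.

Definition residue (c : k) : k0 := proj m (mono c 0 : R^o).

Lemma max_ideal_coef0 (u : R) : u \in m <-> scoef u 0 = 0.
Proof.
split=> [/max_idealP uP|u0].
  by apply/eqP/contraT => /uP[].
apply/max_idealP => h uh; split; first exact: scoef_supp uh.
by move=> h0; rewrite h0 u0 eqxx in uh.
Qed.

Lemma proj_residue (u : R) : proj m (u : R^o) = residue (scoef u 0).
Proof.
apply/projP/max_ideal_coef0.
by rewrite -[(_ - _ : R^o)]/(u - mono (scoef u 0) 0 : R) scoefB scoef_mono // subrr.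
Qed.

Lemma residue_eq0 c : residue c = 0 <-> c = 0.
Proof. by rewrite /residue proj_eq0 max_ideal_coef0 scoef_mono. Qed.

Lemma residueZ (r : R) c : r *: residue c = residue (scoef r 0 * c).
Proof.
rewrite projZ proj_residue; congr residue.
by rewrite scoefM big_ord1 scoef_mono.
Qed.

Lemma residueD c c' : residue (c + c') = residue c + residue c'.
Proof. by rewrite /residue monoD // linearD. Qed.

Lemma residue_surj (q : k0) : exists c, q = residue c.
Proof. by have [u ->] := quot_surj q; exists (scoef u 0); rewrite proj_residue. Qed.

(** As [N] is no sum of an element of [P] and a positive one, only the constant term of [r]
    contributes. *)
Lemma scoefM_min (P : nat -> Prop) N (r u : R) : supp_in P u ->
  (forall i s, P i -> posS s -> N <> (s + i)%N) ->
  scoef (r * u) N = scoef r 0 * scoef u N.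
Proof.
move=> uP Nmin; rewrite scoefM big_ord_recl /= subn0 big1 ?addr0 // => i _.
apply/eqP; rewrite mulf_eq0; apply: contraT; rewrite negb_or => /andP[ri ui].
case: (Nmin _ (bump 0 i) (uP _ ui)); last by rewrite subnKC.
by split=> //; apply: scoef_supp ri.
Qed.

Lemma residue_lin (P : nat -> Prop) N :
  (forall i s, P i -> posS s -> N <> (s + i)%N) ->
  lin_on (supp_in P : R^o -> Prop) (fun u => residue (scoef u N)).
Proof.
move=> Nmin c u u' uP uP'; rewrite residueZ -residueD scoefD.
by congr (residue (_ + _)); apply: scoefM_min uP Nmin.
Qed.

Section Module.
Context (w : lmodType R).
Hypothesis w_canonical : canonical_module w.

Let ExtE i : i != 1%N -> forall c : Ext i k0 w, c = 0.
Proof. by case: w_canonical => _ _ + _; apply. Qed.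

(** An element killed by the maximal ideal gives a map from the residue field to [w], which is zero
    because Ext vanishes in degree [0]. *)
Lemma socle_free (z : w) : (forall s, posS s -> T s *: z = 0) -> z = 0.
Proof.
move=> sz; have mz (u : R) : u \in m -> u *: z = 0.
  apply: (submod_span_ind (V := R^o) (D := fun u : R => u *: z = 0)).
    split=> [|c y y' yz yz']; first by rewrite scale0r.
    by rewrite scalerDl -scalerA yz yz' scaler0 addr0.
  move=> _ [h ha ->]; rewrite tpowE; apply: sz.
  by split; [exact: semigroup_mem | apply/eqP; rewrite -lt0n a_pos].
have reprP (q : k0) (u : R) : q = proj m (u : R^o) ->
    (repr (q : Quotient.quot _) : R) *: z = u *: z.
  move=> qE; apply/eqP; rewrite -subr_eq0 -scalerBl mz //.
  by apply/projP; rewrite projK.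
have gl : linear (fun q : k0 => (repr (q : Quotient.quot _) : R) *: z).
  move=> c q q'; have [u qu] := quot_surj q; have [u' qu'] := quot_surj q'.
  rewrite (reprP _ _ qu) (reprP _ _ qu') (reprP _ (c * u + u')).
    by rewrite scalerDl scalerA.
  by rewrite qu qu' -linearP.
have E0 : forall c : Ext 0 k0 w, c = 0 by apply: ExtE.
have /= := Ext0_eq0P E0 (linear_of gl) (proj m (1 : R^o)).
by rewrite (reprP _ 1) // scale1r.
Qed.

(** For large [s], [t^s] is a multiple of [t^h] and kills [z]; going down in [s], each [t^s z] is
    killed by the maximal ideal, hence zero, until [s = 0] is reached. *)
Lemma torsion_free h c (z : w) : S h -> c != 0 -> mono c h *: z = 0 -> z = 0.
Proof.
move=> hS c0 hz; have {}hz : T h *: z = 0.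
  by rewrite -(monoK v c0 hS) -scalerA hz scaler0.
have [h0|/eqP h0] := eqVneq h 0%N; first by rewrite h0 mono1 scale1r in hz.
have [|B BP] := @finite_colength a h _ hS; first by rewrite lt0n; apply/eqP.
suff Tz N : (N <= B)%N -> forall s, S s -> (B - N <= s)%N -> T s *: z = 0.
  by rewrite -[z]scale1r -mono1; apply: (Tz B) => //; rewrite subnn.
elim: N => [_|N IHN lt_NB] s sS.
  rewrite subn0 => /(BP _ sS)[t tS ->].
  by rewrite -(mulr1 1) -monoM // mulrC -scalerA hz scaler0.
rewrite leq_eqVlt => /predU1P[es|]; last first.
  by rewrite subnSK // => /(IHN (ltnW lt_NB)); apply.
apply: socle_free => t [tS t0]; rewrite scalerA monoM // mulr1.
apply: IHN; [exact: ltnW | exact: semigroupD |].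
by rewrite -es -subnSK // -add1n leq_add2r lt0n; apply/eqP.
Qed.

(** The ideal is reached from the whole ring by removing one exponent at a time: [Q 0] is
    everything, [Q B] is [P], and a proper step is the kernel of a coefficient map onto the residue
    field, where [Ext1_zero_ker] applies. *)
Lemma Ext1_zero_supp (P : nat -> Prop) h0 : sclosed a P -> (forall h, P h -> S h) ->
  P h0 -> Ext1_zero w (supp_in P : R^o -> Prop).
Proof.
move=> Pc PS Ph0.
have [B BP] : exists B, forall s, S s -> (B <= s)%N -> P s.
  have [h00|/eqP h00] := eqVneq h0 0%N.
    by exists 0%N => s sS _; rewrite -(addn0 s) -h00; apply: Pc.
  have [|B BP] := @finite_colength a h0 _ (PS _ Ph0); first by rewrite lt0n; apply/eqP.
  by exists B => s sS /(BP _ sS)[t tS ->]; rewrite addnC; apply: Pc.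
pose Q N h := S h /\ (P h \/ (N <= h)%N).
have Qc N : sclosed a (Q N).
  move=> s h sS [hS Ph]; split; first exact: semigroupD.
  case: Ph => [Ph|le_Nh]; [by left; apply: Pc | right].
  exact: leq_trans le_Nh (leq_addl _ _).
suff QN N : Ext1_zero w (supp_in (Q N) : R^o -> Prop).
  apply: (eq_Ext1_zero _ (QN B)) => u; split=> uQ h uh.
    by have [hS [//|le_Bh]] := uQ h uh; apply: BP.
  by split; [exact: scoef_supp uh | left; apply: uQ].
elim: N => [|N IHN].
  have F := @Ext1_zero_free _ w; apply: eq_Ext1_zero F => u; split=> // _ h uh.
  by split; [exact: scoef_supp uh | right].
have [[NS NP]|NSP] := pselect (S N /\ ~ P N); last first.
  apply: (eq_Ext1_zero _ IHN) => u; split=> uQ h /uQ[hS [Ph|le_Nh]]; split=> //;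
    try (by left); last by right; apply: ltnW.
  have := le_Nh; rewrite leq_eqVlt => /predU1P[eN|]; last by right.
  by left; apply: contrapT => nP; case: NSP; rewrite eN.
have Nmin i s : Q N i -> posS s -> N <> (s + i)%N.
  move=> [iS Pi] [sS s0] eN; case: Pi => [Pi|le_Ni]; first by case: NP; rewrite eN; apply: Pc.
  by case: s0; apply/eqP; rewrite -leqn0 -(leq_add2r i) add0n -eN.
have K0 : Ext1_zero w (fun z : {freeg k0 / R} => free_cover k0 z = 0).
  exact/Ext1_zero_ker_cover/ExtE.
have := Ext1_zero_ker (submod_supp v k (Qc N)) (residue_lin Nmin) _ K0 IHN.
move=> /(_ _)/wrap[q|].
  have [c ->] := residue_surj q; exists (mono c N); last by rewrite scoef_mono // eqxx.
  by apply: supp_mono => //; split=> //; right.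
apply: eq_Ext1_zero => u; split=> [[uQ /residue_eq0 uN] h uh|uQ].
  have [hS [Ph|le_Nh]] := uQ h uh; split=> //; first by left.
  right; rewrite ltn_neqAle le_Nh andbT; apply/eqP => eN.
  by rewrite -eN uN eqxx in uh.
split=> [h uh|].
  by have [hS [Ph|le_Nh]] := uQ h uh; split=> //; [left | right; apply: ltnW].
apply/residue_eq0/eqP/contraT => /uQ[_ [//|]].
by rewrite ltnn.
Qed.

(** The exponents of the ideal [J]; the quotient [R / J] has basis [1], [t^e]. *)
Definition aboveS h := posS h /\ h <> e.

Lemma sclosed_aboveS : sclosed a aboveS.
Proof.
move=> s h sS [hP he]; split; first exact: posSD.
move=> esh; case: he; apply/eqP; rewrite eqn_leq (posS_ge a_increasing a_neq0 hP) // andbT.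
by rewrite -esh leq_addl.
Qed.

(* [eta] generates a copy of [R / J] inside [w / t^(2e) w], where [J] is spanned
   by the [t^h] with [0 < h <> e]: it is read off a map [J -> w] that does not
   extend to [m], which exists because [Ext^1(R / m, w) <> 0]. *)
Lemma dual_generator : exists eta : w,
  (forall u : R, supp_in aboveS u -> exists z, u *: eta = T (e + e) *: z) /\
  ~ exists z, T e *: eta = T (e + e) *: z.
Proof.
have ePos : posS e by apply: posS_multiplicity.
have [eS e0] := ePos.
have eeJ : aboveS (e + e).
  split; first exact: posSD.
  by move/eqP; rewrite -[X in _ == X]addn0 eqn_add2l => /eqP.
have Ms := submod_supp v k (@sclosed_posS a).
have Mmin i s : posS i -> posS s -> e <> (s + i)%N.
  move=> iP [sS s0] ei; case: s0; apply/eqP.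
  by rewrite -leqn0 -(leq_add2r i) add0n -ei (posS_ge a_increasing a_neq0 iP).
have MK (u : R) : supp_in posS u /\ residue (scoef u e) = 0 <-> supp_in aboveS u.
  split=> [[uP /residue_eq0 ue] h uh|uJ].
    by split; [exact: uP | move=> eh; rewrite eh ue eqxx in uh].
  split=> [h /uJ[] //|]; apply/residue_eq0/eqP/contraT => /uJ[_].
  by case.
(* Otherwise every map on [J] extends to the maximal ideal, and [extendable_cover] makes the first
   Ext of the residue field vanish, although it is isomorphic to that field. *)
have [g [gl gE]] : exists g : R -> w, lin_on (supp_in aboveS : R^o -> Prop) g /\
    ~ exists2 G : R -> w, lin_on (supp_in posS : R^o -> Prop) G &
      forall u, supp_in aboveS u -> G u = g u.
  apply: contrapT => allext; have M0 : Ext1_zero w (supp_in posS : R^o -> Prop).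
    by apply: (@Ext1_zero_supp _ e) => //; [exact: sclosed_posS | move=> h []].
  have ext : extendable w (supp_in posS : R^o -> Prop)
      (fun u : R^o => supp_in posS u /\ residue (scoef u e) = 0).
    move=> g gl; apply: contrapT => noG; case: allext; exists g; split.
      by move=> c u u' /MK uJ /MK uJ'; apply: gl.
    by move=> [G Gl eG]; case: noG; exists G => // u /MK/eG.
  have onto (q : k0) : exists2 u : R^o, supp_in posS u & residue (scoef u e) = q.
    have [c ->] := residue_surj q; exists (mono c e); last by rewrite scoef_mono // eqxx.
    exact: supp_mono.
  have cov := extendable_cover Ms (residue_lin Mmin) onto M0 ext.
  have [_ ann] := Ext_annP 1 k0 w 0.
  have E1 (c : Ext 1 k0 w) : c = 0.
    rewrite -[c]scale1r; apply: ann => f fl; have [G Gl eG] := cov f fl.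
    have Gl' : linear G by move=> b y y'; apply: Gl.
    by exists (linear_of Gl') => z z0; rewrite scale1r; apply: eG.
  case: w_canonical => _ _ _ [f [f' fK f'K]].
  have : residue 1 = 0 by rewrite -(f'K (residue 1)) (E1 (f' _)) linear0.
  by move/residue_eq0/eqP; rewrite oner_eq0.
have Jc := submod_supp v k sclosed_aboveS.
have gZ (r u : R) : supp_in aboveS u -> g (r * u) = r *: g u.
  by move=> uJ; apply: (lin_onZ Jc gl).
have TJ : supp_in aboveS (T (e + e)) by apply: supp_mono => //; case: eeJ => -[].
(* For [u] in [J], [u *: eta] is [t^(2e) *: g u]. If [t^e *: eta = t^(2e) *: rho], then [rho] can be
   taken as the value at [t^e] of an extension of [g] to the maximal ideal. *)
exists (g (T (e + e))); split=> [u uJ|[rho erho]].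
  by exists (g u); rewrite -!gZ // mulrC.
case: gE; pose G (u : R) := mono (scoef u e) 0 *: rho + g (u - mono (scoef u e) e).
have GE u : supp_in posS u -> T (e + e) *: G u = u *: g (T (e + e)).
  move=> uP; have uJ : supp_in aboveS (u - mono (scoef u e) e).
    apply/MK; split; first by apply: supp_inB => //; apply: supp_mono.
    by apply/residue_eq0; rewrite scoefB scoef_mono // eqxx subrr.
  rewrite /G scalerDr -(gZ _ _ uJ) mulrC gZ // scalerA [T _ * _]mulrC -scalerA -erho.
  by rewrite scalerA monoM // mulr1 add0n -scalerDl addrC subrK.
exists G => [c u u' uP uP'|u uJ]; last first.
  rewrite /G; have [_ /residue_eq0 ->] := (MK u).2 uJ.
  by rewrite !mono0 // scale0r add0r subr0.
apply/eqP; rewrite -subr_eq0; apply/eqP; apply: (@torsion_free (e + e) 1).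
- exact: semigroupD.
- exact: oner_neq0.
have eu : T (e + e) *: (c *: G u) = c *: (u *: g (T (e + e))).
  by rewrite scalerA mulrC -scalerA GE.
rewrite scalerBr [X in _ - X]scalerDr eu (GE u') //; apply/eqP; rewrite subr_eq0; apply/eqP.
by apply: (etrans (GE (c * u + u') (Ms.2 c u u' uP uP'))); rewrite scalerDl scalerA.
Qed.

End Module.
End CanonicalModule.

Lemma principalE (R : comNzRingType) (b u : R) :
  (u : R^o) \in principal b <-> exists r, u = r * b.
Proof.
split=> [|[r ->]].
  apply: (submod_span_ind (V := R^o) (D := fun u : R => exists r, u = r * b)).
    split=> [|c x y [r ->] [r' ->]]; first by exists 0; rewrite mul0r.
    by exists (c * r + r'); rewrite mulrDl -mulrA.
  by move=> _ ->; exists 1; rewrite mul1r.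
have bI : (b : R^o) \in principal b by apply: submod_span_mem.
exact: (submodZ (submod_in (principal b)) r bI).
Qed.

(** * Monomial ideals *)

Section MonomialIdeal.
Context (v : version) (k : fieldType) (a : seq nat).
Hypotheses (a_pos : forall h, h \in a -> (0 < h)%N) (a_increasing : sorted ltn a)
  (a_neq0 : a != [::]).
Local Notation R := (nsring v k a).
Local Notation S := (semigroup a).
Local Notation posS := (posS a).
Local Notation aboveS := (aboveS a).
Local Notation e := (multiplicity a).
Local Notation mono := (mono v a).
Local Notation m := (max_ideal v k a).
Local Notation T h := (mono (1 : k) h).
Hypothesis minmult : forall s t, posS s -> posS t -> exists2 r, S r & (s + t = e + r)%N.
(* Indices start at [0]: [y ord0] is the generator [x_1] of the paper. *)
Context (n : nat) (c : 'I_n.+1 -> k) (d : 'I_n.+1 -> nat) (y : 'I_n.+1 -> R).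
Hypotheses (c_neq0 : forall i, c i != 0) (dS : forall i, S (d i))
  (d_increasing : forall i j : 'I_n.+1, (i < j)%N -> (d i < d j)%N)
  (d_antichain : forall i j s, S s -> d i = (d j + s)%N -> i = j)
  (yE : forall i, y i = mono (c i) (d i)) (n_gt0 : (0 < n)%N).

Local Notation E := (hull a d).
Local Notation I := (gen (y : 'I_n.+1 -> R^o)).
Let S0 : S 0 := semigroup0 a.

Let e_pos : posS e. Proof. exact: posS_multiplicity. Qed.
Let eS : S e. Proof. by case: e_pos. Qed.
Let e_gt0 : (0 < e)%N. Proof. exact: multiplicity_gt0. Qed.
Let posS_ge h : posS h -> (e <= h)%N. Proof. exact: posS_ge. Qed.
Let posSP h : S h -> (0 < h)%N -> posS h.
Proof. by move=> hS h0; split=> // h00; rewrite h00 in h0. Qed.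

Let max_idealP (u : R) : (u : R^o) \in m <-> supp_in posS u.
Proof. exact: max_idealE. Qed.

Let yI i : (y i : R^o) \in I. Proof. by apply: submod_span_mem; exists i. Qed.

Lemma gen_supp (u : R) : (u : R^o) \in I <-> supp_in E u.
Proof. by rewrite (_ : y = fun i => mono (c i) (d i)) ?gen_hull //; apply: funext. Qed.

Lemma hull_d i : E (d i). Proof. by exists i, 0%N; rewrite addn0. Qed.

Lemma supp_y i : supp_in E (y i).
Proof. by rewrite yE; apply: supp_mono => //; apply: hull_d. Qed.

Lemma d_le (i j : 'I_n.+1) : (i <= j)%N -> (d i <= d j)%N.
Proof. by rewrite leq_eqVlt => /predU1P[/val_inj ->|/d_increasing/ltnW]. Qed.

Lemma hull_ge h : E h -> (d ord0 <= h)%N.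
Proof. move=> [i [s [_ ->]]]; have := @d_le ord0 i isT; lia. Qed.

Lemma scoef_yM i (r : R) h : scoef (y i * r) (d i + h) = c i * scoef r h.
Proof. by rewrite yE scoefMmonoD. Qed.

Lemma y_regular i (r : R) : y i * r = 0 -> r = 0.
Proof.
move=> yr; apply: scoef_inj => h; apply: (mulfI (c_neq0 i)).
by rewrite -scoef_yM yr !scoef0 mulr0.
Qed.

(* [t^e] belongs to [(y_0 : I)]. *)
Definition colon_cond := forall j, exists2 s, S s & (d j + e = d ord0 + s)%N.

(** An exponent of the product is [s + d j + t]; with [d j + e = d ord0 + q] and [s + q = e + r'] it
    equals [d ord0 + r' + t], where [r'] is at least [e], hence positive. *)
Lemma colon_cond_div : colon_cond -> forall b u : R, supp_in posS b -> supp_in E u ->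
  exists2 r, supp_in posS r & b * u = y ord0 * r.
Proof.
move=> st b u bP uP; have [r rE] := shift_exists (b * u) (d ord0) (fun s (sP : posS s) => sP.1).
exists (mono (c ord0)^-1 0 * r).
  apply: supp_inM; first exact: sclosed_posS.
  by move=> h; rewrite rE; case: asboolP => //; rewrite eqxx.
rewrite mulrCA mulrA yE monoM // mulVf // -[RHS]/(T (0 + d ord0) * r) add0n.
apply: scoef_inj => h; rewrite scoefMmono // mul1r.
have buP : scoef (b * u) h != 0 -> exists2 s, posS s & h = (d ord0 + s)%N.
  move=> /scoefM_neq0[s [g [-> /bP sP /uP[j [t [tS ->]]]]]].
  have [q qS eq] := st j; have qP : posS q.
    by apply: posSP => //; have := @d_le ord0 j isT; lia.
  have [r' r'S er] := minmult sP qP; exists (r' + t)%N; last lia.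
  apply: posSP; first exact: semigroupD.
  by have := posS_ge sP; have := posS_ge qP; lia.
have [le_dh|lt_hd] := leqP (d ord0) h; last first.
  apply/eqP/contraT => /buP[s _ eh].
  by move: lt_hd; rewrite eh ltnNge leq_addr.
rewrite rE subnK //; case: asboolP => // nP; apply/eqP/contraT => /buP[s sP eh].
by case: nP; rewrite eh addKn.
Qed.

(** A colon element with nonzero constant term would put the second exponent into [d ord0 + S],
    against the antichain condition. Conversely, [t^e] is tested on each generator. *)
Lemma colon_condP : colon_cond <-> colon (principal (y ord0)) I =i m.
Proof.
have e1n : (1 < n.+1)%N by [].
split=> [st b | colonE j].
- apply/idP/idP => [/asboolP bI|/max_idealP bm].
    apply/max_ideal_coef0 => //; pose j : 'I_n.+1 := Ordinal e1n.
    have /bI/principalE[r er] := yI j.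
    apply/eqP/contraT => b0; have : scoef (y j * b) (d j + 0) != 0.
      by rewrite scoef_yM mulf_neq0.
    rewrite mulrC er mulrC yE scoefMmono //; case: leqP => [le_d|_]; last by rewrite eqxx.
    rewrite mulf_eq0 negb_or => /andP[_ /scoef_supp sS].
    by have := @d_antichain j ord0 _ sS; rewrite subnKC // addn0 => /(_ erefl)/(congr1 val).
  apply/asboolP => u /gen_supp uE; have [r _ ->] := colon_cond_div st bm uE.
  by apply/principalE; exists r; rewrite mulrC.
- have : (T e : R) \in colon (principal (y ord0)) I.
    by rewrite colonE; apply/max_idealP; apply: supp_mono.
  move=> /asboolP/(_ _ (yI j))/principalE[r er].
  have : scoef (y j * T e) (d j + e) != 0.
    by rewrite scoef_yM scoef_mono // eqxx mulr1.
  rewrite mulrC er mulrC yE scoefMmono //; case: leqP => [le_d|_]; last by rewrite eqxx.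
  rewrite mulf_eq0 negb_or => /andP[_ /scoef_supp sS].
  by exists (d j + e - d ord0)%N; rewrite ?subnKC.
Qed.

(** * Koszul cycles and boundaries *)

Lemma koszul_map_delta i : koszul_map y (delta_mx 0 i) = y i.
Proof.
rewrite /koszul_map (bigD1 i) //= mxE !eqxx mul1r big1 ?addr0 // => j ji.
by rewrite mxE (negbTE ji) andbF mul0r.
Qed.

(** Dividing by [x_1] turns [b (x_i e_j - x_j e_i)] into [x_1 (r e_j - r' e_i)], whose second factor
    is a cycle because [x_1] is regular. *)
Lemma colon_cond_koszul (J : submodClosed R^o) : {subset J <= m} -> colon_cond ->
  {subset ideal_mul J (koszul_boundaries y) <= ideal_mul I (koszul_cycles y)}.
Proof.
move=> Jm st z; set N := ideal_mul I _.
apply: (submod_span_ind (submod_in N)) => _ [b [u [/Jm/max_idealP bm uB ->]]].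
apply: (submod_span_ind (D := fun u => b *: u \in N) _ _ uB).
  split=> [|r u' u'' Nu Nu']; first by rewrite scaler0; apply: (submod_in N).1.
  by rewrite scalerDr scalerA mulrC -scalerA; apply: (submod_in N).2.
move=> _ [i [j ->]]; rewrite scalerBr !scalerA.
have [r _ er] := colon_cond_div st bm (@supp_y i).
have [r' _ er'] := colon_cond_div st bm (@supp_y j); rewrite er er'.
rewrite -!scalerA -scalerBr; apply: submod_span_mem.
exists (y ord0), (r *: delta_mx 0 j - r' *: delta_mx 0 i).
split=> //; apply/eqP; rewrite /= linearB !linearZ /=.
rewrite !koszul_map_delta; apply: (y_regular (i := ord0)).
change (y ord0 * (r * y j + r' * - y i) = 0).
by rewrite mulrDr !mulrA -er -er' mulrN mulrAC subrr.
Qed.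

(** * Functionals and the trace ideal *)

Section Functional.
Context (f : hom_module (submodule I) R^o).

Let f0 : R := \val f (Submodule (yI ord0)).

(** The ideal has rank one: [f] is multiplication by the fraction [f0 / y ord0]. *)
Lemma hom_y (u : submodule I) : y ord0 * (\val f u : R) = (\val u : R) * f0.
Proof.
have fZ (r : R) z : r * (\val f z : R) = \val f (r *: z).
  exact/esym/(lin_onZ (submodT _) (fun b x x' _ _ => hom_linear f b x x')).
rewrite /f0 !fZ; congr (\val f _); apply: val_inj.
exact: mulrC.
Qed.

(** A constant term of [f0] would put the second exponent into [d ord0 + S]. Without it, a constant
    term of [f u] would require an exponent of [u] below [d ord0]. *)
Lemma hom_y_supp (u : submodule I) : supp_in posS (\val f u : R).
Proof.
have e1n : (1 < n.+1)%N by [].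
apply/max_idealP/max_ideal_coef0 => //.
have f00 : scoef f0 0 = 0.
  apply/eqP/contraT => f00; pose j : 'I_n.+1 := Ordinal e1n.
  have : scoef (y j * f0) (d j + 0) != 0 by rewrite scoef_yM mulf_neq0.
  rewrite -(hom_y (Submodule (yI j))) yE scoefMmono //.
  case: leqP => [le_d|_]; last by rewrite eqxx.
  rewrite mulf_eq0 negb_or => /andP[_ /scoef_supp sS].
  by have := @d_antichain j ord0 _ sS; rewrite subnKC // addn0 => /(_ erefl)/(congr1 val).
apply: (mulfI (c_neq0 ord0)); rewrite mulr0 -scoef_yM hom_y.
apply/eqP/contraT => /scoefM_neq0[i [j [eij ui fj]]].
have /gen_supp/(_ _ ui)/hull_ge := valP u.
have : j != 0%N by apply: contraNneq fj => ->; rewrite f00.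
lia.
Qed.

(** In degree [d ord0 + e], [hom_y] moves the coefficient from [f u] to [f0], as [d ord0] and [e]
    are the least exponents available; [f0] then tests every [y j]. *)
Lemma hom_y_colon_cond (u : submodule I) : scoef (\val f u : R) e != 0 -> colon_cond.
Proof.
move=> fue; suff f0e : scoef f0 e != 0.
  move=> j; have : scoef (y j * f0) (d j + e) != 0 by rewrite scoef_yM mulf_neq0.
  rewrite -(hom_y (Submodule (yI j))) yE scoefMmono //.
  case: leqP => [le_d|_]; last by rewrite eqxx.
  rewrite mulf_eq0 negb_or => /andP[_ /scoef_supp sS].
  by exists (d j + e - d ord0)%N; rewrite ?subnKC.
have : scoef (y ord0 * (\val f u : R)) (d ord0 + e) != 0 by rewrite scoef_yM mulf_neq0.
rewrite hom_y => /scoefM_neq0[i [j [eij ui fj]]].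
have /gen_supp/(_ _ ui)/hull_ge le_di := valP u.
have /posS_ge le_ej := hom_y_supp fj.
by have -> : e = j by lia.
Qed.

End Functional.

(** If the condition holds, [b] is the value at [y ord0] of multiplication by [b / y ord0]; if it
    fails, all functionals take values in [J], which misses [t^e]. *)
Lemma colon_cond_trace : colon_cond <-> trace_ideal (submodule I) =i m.
Proof.
split=> [st b | trE].
- apply/idP/idP => [|/max_idealP bm].
    apply: (submod_span_ind (submod_in m)) => _ [f [u ->]].
    exact/max_idealP/hom_y_supp.
  have /choice[r rE] (u : submodule I) : exists r : R, b * (\val u : R) = y ord0 * r.
    by have /gen_supp uE := valP u; have [r _ ->] := colon_cond_div st bm uE; exists r.
  have rin : (r : submodule I -> R^o) \in hom_submod (submodule I) R^o.
    apply/asboolP => s u u'; apply/eqP; rewrite -subr_eq0; apply/eqP.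
    apply: (y_regular (i := ord0)).
    change (y ord0 * (r (s *: u + u') - (s * r u + r u')) = 0).
    rewrite mulrBr mulrDr mulrCA -!rE.
    change (b * (s * (\val u : R) + \val u') - (s * (b * \val u) + b * \val u') = 0).
    by rewrite mulrDr mulrCA subrr.
  apply: submod_span_mem; exists (Submodule rin), (Submodule (yI ord0)).
  change (b = r (Submodule (yI ord0))).
  apply/eqP; rewrite -subr_eq0; apply/eqP; apply: (y_regular (i := ord0)).
  by rewrite mulrBr -rE mulrC subrr.
- have : (T e : R^o) \in trace_ideal (submodule I).
    by rewrite trE; apply/max_idealP; apply: supp_mono.
  move=> Ttr; apply: contrapT => nst.
  have /(_ _ Ttr) : forall u : R^o, u \in trace_ideal (submodule I) -> supp_in aboveS u.
    apply: submod_span_ind; first exact/submod_supp/sclosed_aboveS.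
    move=> _ [f [u ->]] h fuh; split; first exact: (hom_y_supp fuh).
    by move=> he; case: nst; apply: (hom_y_colon_cond (f := f) (u := u)); rewrite -he.
  by move/(_ e); rewrite scoef_mono // eqxx oner_neq0 => /(_ isT)[].
Qed.

(** * Jets and the minimal failing index *)

Lemma supp_aboveS (u : R) : supp_in aboveS u <-> scoef u 0 = 0 /\ scoef u e = 0.
Proof.
split=> [uJ|[u0 ue] h uh].
  by split; apply/eqP/contraT => /uJ[[_ ?] ?].
split; last by move=> he; rewrite he ue eqxx in uh.
by split; [exact: scoef_supp uh | move=> h0; rewrite h0 u0 eqxx in uh].
Qed.

(** Up to an element of [J], which contributes nothing in degree [N + e], [r] consists of its terms
    at [0] and [e]. *)
Lemma scoefM_jet (P : nat -> Prop) (N : nat) (r u : R) :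
  (forall i s, P i -> aboveS s -> (N + e)%N <> (s + i)%N) -> supp_in P u ->
  scoef (r * u) (N + e) = scoef r 0 * scoef u (N + e) + scoef r e * scoef u N.
Proof.
move=> Nmin uP; pose r' := r - (mono (scoef r 0) 0 + mono (scoef r e) e).
have e0 : (e == 0%N) = false by apply/negbTE; rewrite -lt0n.
have r'J : supp_in aboveS r'.
  apply/supp_aboveS; rewrite /r' !scoefB !scoefD !scoef_mono // !eqxx e0 (eq_sym 0%N) e0.
  by rewrite addr0 add0r !subrr.
rewrite -[r in scoef (r * u)](subrK (mono (scoef r 0) 0 + mono (scoef r e) e)) -/r'.
rewrite mulrDl scoefD (_ : scoef (r' * u) _ = 0); last first.
  apply/eqP/contraT => /scoefM_neq0[i [j [eij /r'J iJ /uP jP]]].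
  by case: (Nmin j i).
rewrite add0r mulrDl scoefD !scoefMmono // subn0 leq_addl /=.
by rewrite addnK.
Qed.

(* Modulo the ideal [J] spanned by the [t^h] with [h] in [aboveS], [jet N] is
   [R]-linear on [I] when [N + e] is not in [E + aboveS] and [N] is not in
   [E + posS]. *)
Definition jet (N : nat) (u : R) : R := mono (scoef u N) 0 + mono (scoef u (N + e)) e.

Lemma jet_coef N u : scoef (jet N u) 0 = scoef u N /\ scoef (jet N u) e = scoef u (N + e).
Proof.
have e0 : (e == 0%N) = false by apply/negbTE; rewrite -lt0n.
by rewrite /jet !scoefD !scoef_mono // !eqxx e0 (eq_sym 0%N) e0 addr0 add0r.
Qed.

Lemma jetD N u u' : jet N (u + u') = jet N u + jet N u'.
Proof. by rewrite /jet !scoefD !monoD // addrACA. Qed.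

Lemma jet0 N : jet N 0 = 0.
Proof. by rewrite /jet !scoef0 !mono0 // addr0. Qed.

Lemma jet_lin N (P : nat -> Prop) (r u' u : R) :
  (forall i s, P i -> posS s -> N <> (s + i)%N) ->
  (forall i s, P i -> aboveS s -> (N + e)%N <> (s + i)%N) -> supp_in P u ->
  supp_in aboveS (jet N (r * u + u') - (r * jet N u + jet N u')).
Proof.
move=> Nmin Nmin' uP; rewrite jetD opprD addrACA subrr addr0.
have S0' i s : S i -> posS s -> 0%N <> (s + i)%N.
  by move=> _ /posS_ge; lia.
have Se i s : S i -> aboveS s -> (0 + e)%N <> (s + i)%N.
  by move=> iS [/posS_ge es se]; lia.
have anyS (x : R) : supp_in S x by move=> h; apply: scoef_supp.
apply/supp_aboveS; rewrite !scoefB (scoefM_min r (anyS _) S0').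
rewrite -[e in X in _ /\ X]add0n (scoefM_jet r Se (anyS _)) add0n.
have [-> ->] := jet_coef N (r * u); have [-> ->] := jet_coef N u.
by rewrite (scoefM_min r uP Nmin) (scoefM_jet r Nmin' uP) !subrr.
Qed.

Lemma d0_min i s : E i -> posS s -> d ord0 <> (s + i)%N.
Proof. by move=> /hull_ge iE /posS_ge; lia. Qed.

Lemma d0e_min i s : E i -> aboveS s -> (d ord0 + e)%N <> (s + i)%N.
Proof. by move=> /hull_ge iE [/posS_ge es se]; lia. Qed.

Lemma dj_min j i s : E i -> posS s -> d j <> (s + i)%N.
Proof.
move=> [l [t [tS ->]]] [sS s0] ej.
have jl : j = l by apply: (@d_antichain j l (s + t)); [exact: semigroupD | lia].
by move: ej; rewrite jl; lia.
Qed.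

Lemma dj_neq j l : (d j + e)%N <> d l.
Proof.
move=> ejl; have lj : l = j by apply: (@d_antichain l j e).
by move: ejl; rewrite lj; lia.
Qed.

(* The minimality of [j] keeps [d_j + e] out of [E + aboveS]: a decomposition
   would start from some [d_l] with [l < j], and [minmult] would then carry
   [colon_cond] from [l] to [j]. *)
Lemma minimal_failure : ~ colon_cond -> exists2 j, j != ord0 &
  forall i s, E i -> aboveS s -> (d j + e)%N <> (s + i)%N.
Proof.
move=> nst; pose good (j : 'I_n.+1) := `[< exists2 s, S s & (d j + e = d ord0 + s)%N >].
have [j0 j0P] : exists j, ~~ good j.
  apply: contrapT => no; case: nst => j; apply: contrapT => nj.
  by case: no; exists j; apply/asboolP.
have [j jbad jmin] := @arg_minnP _ j0 (fun j => ~~ good j) (fun j => j : nat) j0P.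
exists j.
  apply: contra jbad => /eqP ->; apply/asboolP.
  by exists e.
move=> _ s [l [t [tS ->]]] [sP se] ej.
have [le_es [sS _]] := (posS_ge sP, sP).
have [lt_lj|lt_jl|/val_inj lj] := ltngtP l j.
- have /asboolP[q qS eq] : good l by apply: contraLR lt_lj => /jmin; rewrite -leqNgt.
  have qP : posS q by apply: posSP => //; have := @d_le ord0 l isT; lia.
  have [r rS er] := minmult sP qP; move/negP: jbad; apply; apply/asboolP.
  exists (t + r)%N; first exact: semigroupD.
  lia.
- by have := d_increasing lt_jl; lia.
- by rewrite lj in ej; lia.
Qed.

(** The exponents of the product ideal [J I]. *)
Definition prodS h := exists i s, [/\ E i, aboveS s & h = (s + i)%N].

Lemma sclosed_prodS : sclosed a prodS.
Proof.
move=> t _ tS [i [s [iE sJ ->]]]; exists i, (t + s)%N; split=> //; last by rewrite addnA.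
exact: sclosed_aboveS.
Qed.

Lemma supp_prodS (r u : R) : supp_in aboveS r -> supp_in E u -> supp_in prodS (r * u).
Proof. by move=> rJ uE h /scoefM_neq0[i [j [-> /rJ iJ /uE jE]]]; exists j, i. Qed.

Lemma jet_y0 : jet (d ord0) (y ord0) = mono (c ord0) 0.
Proof.
rewrite /jet yE !scoef_mono // eqxx (_ : (_ == _) = false) ?mono0 ?addr0 //.
by apply/eqP; lia.
Qed.

Lemma jet_yj j : j != ord0 -> jet (d ord0) (y j) = 0.
Proof.
move=> j0; rewrite /jet yE !scoef_mono //.
have -> : (d ord0 == d j) = false.
  by apply/eqP => e0; case/eqP: j0; apply: (@d_antichain j ord0 0); rewrite ?addn0.
have -> : (d ord0 + e == d j)%N = false by apply/eqP/dj_neq.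
by rewrite !mono0 // addr0.
Qed.

Lemma mono_notin_prodS j (b : k) : b != 0 ->
  (forall i s, E i -> aboveS s -> (d j + e)%N <> (s + i)%N) ->
  ~ supp_in prodS (mono b (e + d j)).
Proof.
move=> b0 nE /(_ (d j + e)%N); rewrite scoef_mono ?(addnC e) ?eqxx; last exact: semigroupD.
by move=> /(_ b0)[i [s [iE sJ]]]; apply: nE.
Qed.

(** At [d ord0] and [d ord0 + e] the other terms of the cycle equation vanish: [d i > d ord0] leaves
    room only for a semigroup element below [e], and [0] is excluded by the antichain condition. *)
Lemma koszul_cycle0 z : z \in koszul_cycles y -> supp_in aboveS (z ord0 ord0).
Proof.
move=> zK; have /eqP : koszul_map y z = 0 by apply/eqP.
rewrite /koszul_map big_ord_recl addr_eq0 => /eqP zy.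
have z0 h : c ord0 * scoef (z ord0 ord0) h =
    - \sum_(i < n) scoef (z ord0 (lift ord0 i) * y (lift ord0 i)) (d ord0 + h).
  by rewrite -scoef_yM mulrC zy scoefN scoef_sum.
apply/supp_aboveS; split; apply: (mulfI (c_neq0 ord0)); rewrite z0 mulr0 big1 ?oppr0 // => i _;
  have lt_d0 : (d ord0 < d (lift ord0 i))%N by apply: d_increasing.
  rewrite mulrC yE scoefMmono // addn0; case: leqP => // le_d; lia.
rewrite mulrC yE scoefMmono //; case: leqP => // le_d.
rewrite [scoef _ _](_ : _ = 0) ?mulr0 //; apply/eqP/contraT => /scoef_supp sS.
have [s0|s0] := posnP (d ord0 + e - d (lift ord0 i)).
  by case: (@dj_neq ord0 (lift ord0 i)); lia.
by have /posS_ge := posSP sS s0; lia.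
Qed.

(** First coordinates of [I Z] lie in [J I], whereas [t^e] times the Koszul relation has first
    coordinate [- t^e y j], outside [J I] by the choice of [j]. *)
Lemma koszul_colon_cond :
  {subset ideal_mul (principal (T e)) (koszul_boundaries y)
    <= ideal_mul I (koszul_cycles y)} -> colon_cond.
Proof.
move=> c4; apply: contrapT => /minimal_failure[j j0 nE].
pose z : 'rV[R]_n.+1 := T e *: (y ord0 *: delta_mx ord0 j - y j *: delta_mx ord0 ord0).
have : z \in ideal_mul I (koszul_cycles y).
  apply: c4; apply: submod_span_mem; eexists; eexists.
  split; [|by apply: submod_span_mem; exists ord0, j|by []].
  exact: submod_span_mem.
have bs := submod_supp v k sclosed_prodS.
have zb (u : 'rV[R]_n.+1) : u \in ideal_mul I (koszul_cycles y) -> supp_in prodS (u ord0 ord0).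
  apply: (submod_span_ind (D := fun u : 'rV[R]_n.+1 => supp_in prodS (u ord0 ord0))).
    split=> [|r z1 z2 b1 b2]; rewrite !mxE; first by case: bs.
    exact: bs.2.
  move=> _ [b [u' [/gen_supp bI /koszul_cycle0 uJ ->]]]; rewrite !mxE mulrC.
  exact: supp_prodS.
move/zb; rewrite !mxE !eqxx (eq_sym ord0) (negbTE j0) /= mulr0 mulr1 sub0r mulrN yE monoM //.
rewrite mul1r => nb; apply: (mono_notin_prodS (c_neq0 j) nE).
by rewrite -[mono _ _]opprK -mulN1r; apply: supp_inM => //; apply: sclosed_prodS.
Qed.

(** * The first Tor module *)

Lemma colon_cond_Tor1 (b : R) : colon_cond -> supp_in posS b ->
  forall z : Tor 1 (submodule I) (quot_module I), b *: z = 0.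
Proof.
move=> st bm; apply/Tor1_annP => z z0 zI.
have /choice[r rE] u : exists r, b * coeff u z = y ord0 * r.
  by have [|r _ ->] := colon_cond_div st bm (u := coeff u z); [exact/gen_supp/zI | exists r].
pose z' : {freeg (submodule I) / R} := \sum_(u <- dom z) r u *: <<u>>.
have bz : b *: z = y ord0 *: z'.
  rewrite [z in LHS]freegE !scaler_sumr; apply: eq_bigr => u _.
  by rewrite !scalerA rE.
rewrite bz; apply: submod_span_mem; exists (y ord0), z'; split=> //.
(* Since [b *: z = y ord0 *: z'], regularity of [y ord0] makes [z'] a syzygy again. *)
have yz0 : y ord0 *: free_cover (submodule I) z' = 0.
  by rewrite -coverZ -bz coverZ z0 scaler0.
by apply/eqP/val_inj; apply: (y_regular (i := ord0)); apply: (congr1 val yz0).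
Qed.

Definition jet_cover : {linear {freeg (submodule I) / R} -> R^o} :=
  fglift (fun u : submodule I => jet (d ord0) (\val u) : R^o).

Lemma jet_coverU u : jet_cover <<u>> = jet (d ord0) (\val u).
Proof. by rewrite /jet_cover /= fgliftU. Qed.

Lemma supp_submodule (u : submodule I) : supp_in E (\val u : R).
Proof. by apply/gen_supp; apply: valP. Qed.

(** As [jet] is linear modulo [J], [jet_cover] agrees modulo [J] with [jet] composed with the
    cover. *)
Lemma jet_cover_ker z : free_cover (submodule I) z = 0 -> supp_in aboveS (jet_cover z).
Proof.
have js := submod_supp v k (sclosed_aboveS a_increasing a_neq0).
have jd0 (r u u' : R) := @jet_lin (d ord0) E r u' u d0_min d0e_min.
suff H : supp_in aboveS (jet_cover z - jet (d ord0) (\val (free_cover (submodule I) z)) : R).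
  move=> z0; move: H; rewrite z0.
  have -> : jet (d ord0) (\val (0 : submodule I)) = 0.
    by rewrite /jet [\val _]/(0 : R) !scoef0 !mono0 // addr0.
  by rewrite subr0.
elim/freeg_ind: z => [|u]; last first.
  by rewrite jet_coverU coverU subrr; case: js.
split=> [|r z z' Hz Hz'].
  rewrite linear0 (linear0 (free_cover _)) [\val _]/(0 : R) sub0r /jet !scoef0 !mono0 //.
  by rewrite addr0 oppr0; case: js.
rewrite !linearP; set u := free_cover _ z in Hz *; set u' := free_cover _ z' in Hz' *.
change (supp_in aboveS (r * (jet_cover z : R) + (jet_cover z' : R) -
  jet (d ord0) (r * \val u + \val u'))).
rewrite -[jet _ (r * _ + _)](subrK (r * jet (d ord0) (\val u) + jet (d ord0) (\val u'))).
rewrite opprD [- (_ - _) - _]addrC addrA (opprD (r * jet _ _)) addrACA -mulrBr.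
apply: supp_inB; last first.
  by rewrite -opprD; apply: jd0; apply: supp_submodule.
by apply: supp_inD => //; apply: supp_inM => //; apply: sclosed_aboveS.
Qed.

Definition gen_elt i : submodule I := Submodule (yI i).

Definition koszul_relation j : {freeg (submodule I) / R} :=
  y ord0 *: <<gen_elt j>> - y j *: <<gen_elt ord0>>.

Lemma koszul_relation_ker j : free_cover (submodule I) (koszul_relation j) = 0.
Proof.
rewrite coverB !coverZ !coverU; apply: val_inj.
change (y ord0 * y j - y j * y ord0 = 0).
by rewrite mulrC subrr.
Qed.

Lemma jet_cover_koszul j : j != ord0 ->
  jet_cover (koszul_relation j) = - (y j * mono (c ord0) 0) :> R.
Proof.
move=> j0; rewrite /koszul_relation linearB !linearZ /= !fgliftU /= jet_yj //.
by rewrite jet_y0 scaler0 add0r scalerN.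
Qed.

(** [jet_cover] sends [I K], with [K] the syzygies, into [J I], but [t^e] times the Koszul relation
    to a nonzero multiple of [t^(e + d j)], outside [J I]. *)
Lemma Tor1_colon_cond :
  (forall z : Tor 1 (submodule I) (quot_module I), T e *: z = 0) -> colon_cond.
Proof.
move=> /Tor1_annP c2; apply: contrapT => /minimal_failure[j j0 nE].
have bs := submod_supp v k sclosed_prodS.
have jb z : z \in ideal_mul I (ker_lin (free_cover (submodule I))) -> supp_in prodS (jet_cover z).
  apply: (submod_span_ind (D := fun z => supp_in prodS (jet_cover z))).
    split=> [|r z1 z2 b1 b2]; rewrite ?linear0 ?linearP; first by case: bs.
    exact: bs.2.
  move=> _ [b [u [/gen_supp bI /eqP uK ->]]]; rewrite linearZ.
  change (supp_in prodS (b * (jet_cover u : R))); rewrite mulrC.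
  by apply: supp_prodS => //; apply: jet_cover_ker.
have /jb : T e *: koszul_relation j \in ideal_mul I (ker_lin (free_cover (submodule I))).
  apply: c2 => [|u]; first exact: koszul_relation_ker.
  rewrite coeffB !coeffZ !coeffU !mul1r; apply: (submodB (submod_in I)).
    by rewrite mulrC; apply: (submodZ (submod_in I) _ (yI ord0)).
  by rewrite mulrC; apply: (submodZ (submod_in I) _ (yI j)).
rewrite linearZ [jet_cover _]jet_cover_koszul //.
move=> /(supp_inM (r := -1) sclosed_prodS).
change (supp_in prodS (-1 * (T e * - (y j * mono (c ord0) 0)) : R) -> False);
rewrite mulrN mulN1r opprK yE [mono (c j) _ * _]monoM // addn0 monoM // mul1r.
apply: mono_notin_prodS => //.
by rewrite mulf_neq0.
Qed.

(** * The exterior square *)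

Lemma colon_cond_exterior (b : R) : colon_cond -> supp_in posS b ->
  forall z : exterior_square (submodule I), b *: z = 0.
Proof.
move=> st bm z; have [t ->] := quot_surj (z : quot_module _).
have [f ->] := quot_surj (t : quot_module _); set N := submod_span _ in z *.
set B := submod_span _; pose D g := b *: proj N (proj B g) = 0.
(* Used twice: [b p = r y ord0], and as [r] stays in the maximal ideal, [r q = r' y ord0]; so [b]
   times a wedge is a multiple of [y ord0] wedged with itself. *)
have core (r : R) (u : submodule I) : supp_in posS r ->
    exists2 r' : R, supp_in posS r' & r *: u = r' *: gen_elt ord0.
  move=> rP; have [r' r'P er] := colon_cond_div st rP (@supp_submodule u).
  exists r' => //; apply: val_inj.
  by change (r * (\val u : R) = r' * y ord0); rewrite er mulrC.
rewrite -[_ = 0]/(D f); elim/freeg_ind: f => [|[p q]].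
  split=> [|r g h Dg Dh]; first by rewrite /D !linear0 ?scaler0.
  by rewrite /D !projD -!projZ scalerDr scalerA mulrC -scalerA Dg Dh scaler0 addr0.
rewrite /D projZ; apply/proj_eq0.
have [r rP ep] := core b p bm; have [r' _ eq] := core r q rP.
have -> : b *: proj B <<(p, q)>> = r' *: tens (gen_elt ord0) (gen_elt ord0).
  by rewrite -/(tens p q) -tensZl ep tensZl -tensZr eq tensZr.
have yy : tens (gen_elt ord0) (gen_elt ord0) \in N by apply: submod_span_mem; eexists.
exact: (submodZ (submod_in N) r' yy).
Qed.

(** The form [jet p * q - jet q * p] is alternating, and bilinear modulo [J I]; on [y ord0] and
    [y j] it gives a nonzero scalar times [y j], which [t^e] does not bring into [J I]. *)
Lemma exterior_colon_cond : (forall z : exterior_square (submodule I), T e *: z = 0) -> colon_cond.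
Proof.
move=> c3; apply: contrapT => /minimal_failure[j j0 nE].
have bs := submod_supp v k sclosed_prodS.
pose phi : {linear {freeg (submodule I * submodule I) / R} -> R^o} :=
  fglift (fun p : submodule I * submodule I =>
      jet (d ord0) (\val p.1) * \val p.2 - jet (d ord0) (\val p.2) * \val p.1 : R^o).
have phiU p q : phi <<(p, q)>> =
    jet (d ord0) (\val p) * \val q - jet (d ord0) (\val q) * \val p.
  by rewrite /phi /= fgliftU.
have jetM (r u x : R) : supp_in E u -> supp_in E x ->
    supp_in prodS ((jet (d ord0) (r * u) - r * jet (d ord0) u) * x).
  move=> uE; apply: supp_prodS.
  by have := @jet_lin (d ord0) E r 0 u d0_min d0e_min uE; rewrite jet0 !addr0.
have phi_rel f : f \in submod_span (@bilinear_relation R (submodule I) (submodule I)) ->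
    supp_in prodS (phi f).
  apply: (submod_span_ind (D := fun f => supp_in prodS (phi f))).
    split=> [|r f1 f2 b1 b2]; rewrite ?linear0 ?linearP; first by case: bs.
    exact: bs.2.
  move=> _ [p p' q|p q q'|r p q|r p q]; rewrite !linearB ?linearZ /= !phiU.
  - rewrite [X in supp_in prodS X](_ : _ = 0 :> R); first by case: bs.
    rewrite -[\val (p + p')]/(\val p + \val p' : R) jetD; ring.
  - rewrite [X in supp_in prodS X](_ : _ = 0 :> R); first by case: bs.
    rewrite -[\val (q + q')]/(\val q + \val q' : R) jetD; ring.
  - have := jetM r _ _ (@supp_submodule p) (@supp_submodule q).
    rewrite -[\val (r *: p)]/(r * \val p : R); congr (supp_in prodS _).
    rewrite -[_ *: _]/(r * - (jet (d ord0) (\val p) * \val q - jet (d ord0) (\val q) * \val p)).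
    ring.
  - have := supp_inM (r := -1) sclosed_prodS (jetM r _ _ (@supp_submodule q) (@supp_submodule p)).
    rewrite -[\val (r *: q)]/(r * \val q : R); congr (supp_in prodS _).
    rewrite -[_ *: _]/(r * - (jet (d ord0) (\val p) * \val q - jet (d ord0) (\val q) * \val p)).
    ring.
pose D (t : tensor (submodule I) (submodule I)) :=
  exists2 f, t = proj _ f & supp_in prodS (phi f).
have Ds : submod D.
  split=> [|r _ _ [f -> fb] [g -> gb]]; first by exists 0; rewrite ?linear0 //; case: bs.
  by exists (r *: f + g); rewrite linearP //; apply: bs.2.
have := c3 (proj _ (tens (gen_elt ord0) (gen_elt j))); rewrite projZ => /proj_eq0.
case/(submod_span_ind Ds) => [_ [u ->]|f ef fb].
  by exists <<(u, u)>> => //; rewrite phiU subrr; case: bs.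
have : supp_in prodS (phi (T e *: <<(gen_elt ord0, gen_elt j)>> - f)).
  by apply: phi_rel; apply/projP; rewrite -projZ -ef.
move=> /(supp_inD fb); rewrite linearB linearZ /= phiU addrC subrK jet_y0 jet_yj //.
rewrite mul0r subr0.
change (supp_in prodS (T e * (mono (c ord0) 0 * y j)) -> False).
rewrite yE [mono (c ord0) _ * _]monoM // add0n monoM // mul1r.
by apply: mono_notin_prodS => //; rewrite mulf_neq0.
Qed.

(** * The first Ext module *)

Section Ext.
Context (w : lmodType R).
Hypothesis w_canonical : canonical_module w.
Local Notation IM := (submodule I).

Let hullS h : E h -> S h. Proof. by move=> [i [s [sS ->]]]; apply: semigroupD. Qed.

Let IExt : Ext1_zero w (supp_in E : R^o -> Prop).
Proof. exact: (Ext1_zero_supp a_pos w_canonical (@sclosed_hull a _ d) hullS (hull_d ord0)). Qed.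

Lemma y_reg_w i (z : w) : y i *: z = 0 -> z = 0.
Proof. by rewrite yE; apply: torsion_free. Qed.

Lemma homZ (f : hom_module IM w) (r : R) (u : IM) : \val f (r *: u) = r *: \val f u.
Proof. exact/(lin_onZ (submodT _) (fun b x x' _ _ => hom_linear f b x x')). Qed.

Lemma cover_hull_lin (D : {freeg IM / R} -> Prop) :
  lin_on D (fun z => (\val (free_cover IM z) : R^o)).
Proof. by move=> r z z' _ _; rewrite linearP. Qed.

(** The values of [g] at [y ord0] extend to [G0] because the first Ext of [I] into [w] vanishes;
    with [rho u = b u / y ord0], the map [z |-> (u |-> rho u *: G0 z)] extends [b g]. *)
Lemma colon_cond_Ext1 (b : R) : colon_cond -> supp_in posS b ->
  forall z : Ext 1 IM (hom_module IM w), b *: z = 0.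
Proof.
move=> st bm; apply/(Ext_annP b IM _ 0) => g gl.
have [|||G0 G0l eG0] := IExt (submodT _) (cover_hull_lin (D := fun _ => True)) _ _
    (g := fun z => \val (g z) (gen_elt ord0)).
- by move=> z _; apply: supp_submodule.
- by move=> u /gen_supp uI; exists <<(Submodule uI : IM)>>; rewrite // coverU.
- move=> r z z' [_ z0] [_ z'0]; rewrite gl //; exact: val_inj.
have /choice[rho rhoE] (u : IM) : exists r : R, b * (\val u : R) = y ord0 * r.
  by have [r _ ->] := colon_cond_div st bm (@supp_submodule u); exists r.
have rho_lin (r : R) u u' : rho (r *: u + u') = r * rho u + rho u'.
  apply/eqP; rewrite -subr_eq0; apply/eqP; apply: (y_regular (i := ord0)).
  rewrite mulrBr mulrDr mulrCA -!rhoE -[\val (r *: u + u')]/(r * \val u + \val u' : R).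
  ring.
have Gin z : (fun u => rho u *: G0 z) \in hom_submod IM w.
  by apply/asboolP => r u u'; rewrite rho_lin scalerDl scalerA.
have Gl : linear (fun z => Submodule (Gin z)).
  move=> r z z'; apply: val_inj; apply: funext => u.
  change (rho u *: G0 (r *: z + z') = r *: (rho u *: G0 z) + rho u *: G0 z').
  by rewrite G0l // scalerDr !scalerA mulrC.
exists (linear_of Gl) => z z0; apply: val_inj; apply: funext => u.
change (rho u *: G0 z = b *: \val (g z) u).
have z0' : True /\ (\val (free_cover IM z) : R^o) = 0 by rewrite z0.
rewrite (eG0 z z0') -!homZ; congr (\val (g z) _); apply: val_inj.
by change (rho u * y ord0 = b * \val u); rewrite rhoE mulrC.
Qed.

(** On syzygies the product of [jet_cover] and a lift [Q] of [u |-> jet (d j) u *: eta] is divisible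
    by [t^(2e)]. An extension of [t^e] times the quotient would give a symmetric pairing on [I]
    whose values at [(y j, y ord0)] and [(y ord0, y j)] differ modulo [t^(2e) w]. *)
Lemma Ext1_colon_cond : (forall z : Ext 1 IM (hom_module IM w), T e *: z = 0) -> colon_cond.
Proof.
move=> /(Ext_annP (T e) IM _ 0) c1; apply: contrapT => /minimal_failure[j j0 nE].
have [eta [etaJ etae]] := dual_generator a_pos a_increasing a_neq0 w_canonical.
pose t := T (e + e); have tS : S (e + e) by apply: semigroupD.
have treg (z : w) : t *: z = 0 -> z = 0 by apply: torsion_free => //; apply: oner_neq0.
have Es := submod_supp v k (@sclosed_hull a _ d).
have [|Q Ql QE] := lift_mod (phi := fun u : R^o => jet (d j) u *: eta) Es IExt treg.
  move=> r u u' uE uE'; rewrite scalerA -scalerDl -scalerBl; apply: etaJ.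
  exact: (@jet_lin (d j) E r u' u (@dj_min j) nE uE).
have LQ (r : R) (u : R) : supp_in aboveS r -> supp_in E u -> exists z, r *: Q u = t *: z.
  move=> rJ /QE[z ez]; have [|z' ez'] := etaJ (r * jet (d j) u).
    by rewrite mulrC; apply: supp_inM => //; apply: sclosed_aboveS.
  exists (r *: z + z'); rewrite scalerDr scalerA mulrC -scalerA -ez -ez'.
  by rewrite scalerBr scalerA subrK.
have /choice[gam gamE] (f : {freeg IM / R}) : exists h : hom_module IM w,
    free_cover IM f = 0 -> forall u, t *: \val h u = (jet_cover f : R) *: Q (\val u).
  have [f0|f0] := pselect (free_cover IM f = 0); last by exists 0.
  have /choice[h hE] (u : IM) : exists z, (jet_cover f : R) *: Q (\val u) = t *: z.
    by apply: LQ (jet_cover_ker f0) (@supp_submodule u).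
  have hin : (h : IM -> w) \in hom_submod IM w.
    apply/asboolP => r u u'; apply/eqP; rewrite -subr_eq0; apply/eqP/treg.
    rewrite scalerBr scalerDr scalerA mulrC -scalerA -!hE.
    rewrite [Q _](Ql r _ _ (@supp_submodule u) (@supp_submodule u')).
    by rewrite scalerDr !scalerA mulrC subrr.
  by exists (Submodule hin) => _ u; rewrite hE.
have [|G GE] := c1 gam.
  move=> r z z' z0 z'0; apply: val_inj; apply: funext => u.
  change (\val (gam (r *: z + z')) u = r *: \val (gam z) u + \val (gam z') u).
  apply/eqP; rewrite -subr_eq0; apply/eqP/treg.
  have zz0 : free_cover IM (r *: z + z') = 0 by rewrite linearP z0 z'0 scaler0 addr0.
  rewrite scalerBr scalerDr scalerA mulrC -scalerA !gamE // linearP.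
  by rewrite scalerDl scalerA subrr.
(* [H] vanishes on syzygies in its first argument, so it descends to a pairing on [I], symmetric
   because [I] has rank one and [w] is torsion free. *)
pose H f (u : IM) : w := T e *: ((jet_cover f : R) *: Q (\val u)) - t *: \val (G f) u.
have H0 f u : free_cover IM f = 0 -> H f u = 0.
  move=> f0; rewrite /H GE // -gamE //.
  change (T e *: (t *: \val (gam f) u) - t *: (T e *: \val (gam f) u) = 0).
  by rewrite !scalerA mulrC subrr.
pose Y i := gen_elt i.
have GL r s f g u :
    \val (G (r *: f - s *: g)) u = r *: \val (G f) u - s *: \val (G g) u.
  by rewrite linearB !linearZ.
have HL r s f g u : H (r *: f - s *: g) u = r *: H f u - s *: H g u.
  rewrite /H GL; have -> : jet_cover (r *: f - s *: g) = r * jet_cover f - s * jet_cover g :> R.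
    by rewrite linearB !linearZ.
  rewrite scalerBl !scalerBr !scalerA (mulrCA (T e) r) (mulrCA (T e) s).
  by rewrite (mulrC t r) (mulrC t s) !opprD !opprK addrACA.
have Hk u : y ord0 *: H <<Y j>> u = y j *: H <<Y ord0>> u.
  by apply/eqP; rewrite -subr_eq0 -HL H0 // koszul_relation_ker.
have HZ f r u : H f (r *: u) = r *: H f u.
  rewrite /H homZ; have -> : Q (\val (r *: u)) = r *: Q (\val u).
    exact: (lin_onZ Es Ql r (@supp_submodule u)).
  by rewrite scalerBr !scalerA (mulrC t r) (mulrC _ r) mulrA.
have Hsym : H <<Y j>> (Y ord0) = H <<Y ord0>> (Y j).
  apply/eqP; rewrite -subr_eq0; apply/eqP; apply: (@y_reg_w ord0).
  rewrite scalerBr Hk -!HZ; apply/eqP; rewrite subr_eq0; apply/eqP.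
  by congr H; apply: val_inj; apply: mulrC.
move: Hsym; rewrite /H !jet_coverU jet_yj // jet_y0 scale0r scaler0 sub0r.
have [z ez] := QE _ (@supp_y j); have -> : Q (\val (Y j)) = jet (d j) (y j) *: eta + t *: z.
  by rewrite -ez addrC subrK.
have -> : jet (d j) (y j) = mono (c j) 0.
  rewrite /jet yE !scoef_mono // eqxx (_ : (_ == _) = false) ?mono0 ?addr0 //.
  by apply/eqP; lia.
set A := \val (G _) _; set B := \val (G _) _ => eAB; apply: etae.
exists (mono (c ord0 * c j)^-1 0 *: (B - A - (T e * mono (c ord0) 0) *: z)).
have cc : c ord0 * c j != 0 by rewrite mulf_neq0.
have -> : eta = mono (c ord0 * c j)^-1 0 *: ((mono (c ord0) 0 * mono (c j) 0) *: eta).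
  by rewrite scalerA !monoM // mulVf // mono1 scale1r.
have swap (r s : R) (x : w) : r *: (s *: x) = s *: (r *: x) by rewrite !scalerA mulrC.
rewrite swap [RHS]swap; congr (_ *: _).
have eBA : t *: B - t *: A =
    T e *: (mono (c ord0) 0 *: (mono (c j) 0 *: eta + t *: z)) by rewrite eAB addrC subrK.
rewrite !(scalerBr t) eBA !scalerDr !scalerA.
by rewrite mulrA (mulrC t) addrK.
Qed.

End Ext.

(** * The syzygy module *)

Local Notation Z := (koszul_cycles y).

(* For [v = Graded] this is convertible to [ring_grading]. *)
Definition scoef_grading : int -> R -> Prop :=
  fun j u => forall h : nat, scoef u h != 0 -> h%:Z = j.

Local Notation Zgrade := (sub_grading (N := Z)
  (row_grading (fun i => shift_grading scoef_grading (d i)))).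
Local Notation mgrade := (sum_grading (fun i : 'I_n => shift_grading
  (sub_grading (N := m) scoef_grading) (d (lift ord0 i)))).

Lemma koszul_map0 (z : 'rV[R]_n.+1) : z \in Z <-> y ord0 * z ord0 ord0 =
  - \sum_(i < n) y (lift ord0 i) * z ord0 (lift ord0 i).
Proof.
have zE : koszul_map y z = y ord0 * z ord0 ord0 +
    \sum_(i < n) y (lift ord0 i) * z ord0 (lift ord0 i).
  rewrite /koszul_map big_ord_recl mulrC; congr (_ + _).
  by apply: eq_bigr => i _; rewrite mulrC.
split=> [zK|zK]; last by apply/eqP; rewrite /= zE zK addNr.
have /eqP : koszul_map y z = 0 by apply/eqP.
by rewrite zE addr_eq0 => /eqP.
Qed.

(** A constant term at [i] would have to cancel in degree [d i] against a multiple of another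
    generator, excluded by the antichain condition. *)
Lemma koszul_cycle_supp (z : 'rV[R]_n.+1) i : z \in Z -> supp_in posS (z ord0 i).
Proof.
move=> zK; apply/max_idealP/(max_ideal_coef0 a_pos).
have /(congr1 (fun u : R => scoef u (d i))) : koszul_map y z = 0 by apply/eqP.
rewrite /koszul_map scoef0 scoef_sum (bigD1 i) //= [X in _ + X]big1 ?addr0.
  rewrite mulrC -[d i in LHS]addn0 scoef_yM => /eqP.
  by rewrite mulf_eq0 (negbTE (c_neq0 i)) => /eqP.
move=> l li; apply/eqP/contraT; rewrite mulrC yE scoefMmono //.
case: leqP => [le_d|_]; last by rewrite eqxx.
rewrite mulf_eq0 negb_or => /andP[_ /scoef_supp sS].
by case/eqP: li; apply/esym/(d_antichain sS); rewrite subnKC.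
Qed.

Lemma koszul_cycle_eq0 (z : submodule Z) :
  (forall i : 'I_n, (\val z) ord0 (lift ord0 i) = 0) -> z = 0.
Proof.
move=> z0; apply: val_inj; apply/rowP => i; rewrite [RHS]mxE.
case: (unliftP ord0 i) => [j ->|->]; first exact: z0.
apply: (y_regular (i := ord0)).
have /koszul_map0 -> := valP z.
by rewrite big1 ?oppr0 // => j _; rewrite z0 mulr0.
Qed.

Definition tail (z : submodule Z) : {ffun 'I_n -> submodule m} :=
  [ffun i => Submodule ((max_idealP _).2 (koszul_cycle_supp (i := lift ord0 i) (valP z)))].

Lemma tailE z i : \val (tail z i) = (\val z) ord0 (lift ord0 i) :> R.
Proof. by rewrite ffunE. Qed.

Lemma tail_linear : linear tail.
Proof.
move=> r z z'; apply/ffunP => i; apply: val_inj.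
have -> : (r *: tail z + tail z') i = r *: tail z i + tail z' i by rewrite 2!ffunE.
change (\val (tail (r *: z + z') i) = r * (\val (tail z i) : R) + (\val (tail z' i) : R)).
rewrite !tailE.
change ((r *: \val z + \val z') ord0 (lift ord0 i) =
  r * (\val z) ord0 (lift ord0 i) + (\val z') ord0 (lift ord0 i)).
by rewrite !mxE.
Qed.

(** [tail] is injective since [y ord0] is regular, and onto since each product of an entry with its
    generator is divisible by [y ord0], which gives the missing first coordinate. *)
Lemma colon_cond_syzygy : colon_cond -> graded_isomorphic Zgrade mgrade.
Proof.
move=> st; have /choice[g gE] (h : {ffun 'I_n -> submodule m}) :
    exists z : submodule Z, tail z = h.
  have /choice[r rE] (i : 'I_n) : exists r : R,
      (\val (h i) : R) * y (lift ord0 i) = y ord0 * r.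
    have /max_idealP hP := valP (h i).
    by have [r _ ->] := colon_cond_div st hP (@supp_y (lift ord0 i)); exists r.
  pose z : 'rV[R]_n.+1 := \row_j (if unlift ord0 j is Some i then \val (h i) : R
                                  else - \sum_i r i).
  have zl i : z ord0 (lift ord0 i) = \val (h i) :> R by rewrite mxE liftK.
  have zK : z \in Z.
    apply/koszul_map0; rewrite [z ord0 ord0]mxE unlift_none mulrN mulr_sumr.
    by congr (- _); apply: eq_bigr => i _; rewrite -rE zl mulrC.
  by exists (Submodule zK); apply/ffunP => i; apply: val_inj; rewrite [LHS]tailE zl.
have tail0 z : tail z = 0 -> z = 0.
  by move=> z0; apply: koszul_cycle_eq0 => i; rewrite -tailE z0 ffunE.
exists (linear_of tail_linear); split.
  exists g => [z|h]; last exact: gE.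
  apply/eqP; rewrite -subr_eq0; apply/eqP/tail0.
  by rewrite -[tail _]/(linear_of tail_linear (g (tail z) - z)) linearB /= gE subrr.
move=> j z; split=> [zj i|zj i].
  by move=> h; rewrite /sub_grading [\val _]tailE; apply: zj.
case: (unliftP ord0 i) => [l ->|->] h.
  by move: (zj l h); rewrite [\val _]tailE; apply.
move=> zh; have : scoef (y ord0 * (\val z) ord0 ord0) (d ord0 + h) != 0.
  by rewrite scoef_yM mulf_neq0.
have /koszul_map0 -> := valP z; rewrite scoefN oppr_eq0 scoef_sum => nz.
have [l] : exists l, scoef (y (lift ord0 l) * (\val z) ord0 (lift ord0 l)) (d ord0 + h) != 0.
  apply: contrapT => no; case/eqP: nz; apply: big1 => l _; apply/eqP/contraT => nl.
  by case: no; exists l.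
rewrite yE scoefMmono //; case: leqP => [le_d|_]; last by rewrite eqxx.
rewrite mulf_eq0 negb_or => /andP[_ nl].
have := zj l (d ord0 + h - d (lift ord0 l))%N.
by rewrite /sub_grading [\val _]tailE => /(_ nl); lia.
Qed.

(* In the degree [d_j + e] the inverse isomorphism followed by [tail] is an
   injective endomorphism of a finite-dimensional space, encoded here as the
   matrix [L] extended by the identity outside the relevant indices [A]; so
   [t^e] in position [j] lifts to a syzygy. *)
Lemma syzygy_colon_cond : graded_isomorphic Zgrade mgrade -> colon_cond.
Proof.
move=> [f [[g fK gK] fgr]] j.
case: (unliftP ord0 j) => [j' ->|->]; last by exists e.
pose l (i : 'I_n) := lift ord0 i.
pose D := (d (l j') + e)%N.
(* [A] selects the positions whose summand is nonzero in degree [D]; truncated subtraction yields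
   [0], hence exclusion, when [d (l i) > D]. *)
pose A i := `[< posS (D - d (l i))%N >].
pose s i := (D - d (l i))%N.
have /choice[b bE] i : exists u : submodule m, (\val u : R) = if A i then T (s i) else 0.
  case: ifP => [/asboolP iA|_]; last by exists 0.
  have sm : (T (s i) : R) \in m by apply/max_idealP; apply: supp_mono => //; case: iA.
  by exists (Submodule sm).
pose B i : {ffun 'I_n -> submodule m} := [ffun t => if t == i then b i else 0].
have BE i t : \val (B i t) = (if t == i then (if A i then T (s i) else 0) else 0) :> R.
  by rewrite ffunE; case: eqP => // _; rewrite bE.
pose z i : submodule Z := g (B i).
have zD i t h : scoef ((\val (z i)) ord0 (l t)) h != 0 -> A t /\ h = s t.
  move=> nz; have : Zgrade D (z i).
    apply/fgr; rewrite gK => {nz}t {}h; rewrite /sub_grading BE.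
    case: (t =P i) => [->|_]; last by rewrite scoef0 eqxx.
    case: ifP => [/asboolP[sS s0]|_]; last by rewrite scoef0 eqxx.
    rewrite scoef_mono //; case: (h =P s i) => [->|_]; last by rewrite eqxx.
    by move=> _; rewrite /s /l in s0 *; lia.
  move=> /(_ (l t) h nz) hD; have hP := koszul_cycle_supp (valP (z i)) nz.
  have hs : h = s t by have := posS_ge hP; rewrite /s; lia.
  by split=> //; apply/asboolP; rewrite hs in hP.
pose ZV (q : 'rV[k]_n) : submodule Z := \sum_i (if A i then mono (q ord0 i) 0 *: z i else 0).
have ZVE q t h : scoef ((\val (ZV q)) ord0 (l t)) h =
    \sum_i (if A i then q ord0 i * scoef ((\val (z i)) ord0 (l t)) h else 0).
  pose F (x : submodule Z) := scoef ((\val x) ord0 (l t) : R) h.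
  have F0 : F 0 = 0 by rewrite /F -[\val 0]/(0 : 'rV[R]_n.+1) mxE scoef0.
  have FD : {morph F : x x' / x + x'}.
    by move=> x x'; rewrite /F -scoefD -[\val (x + x')]/(\val x + \val x' : 'rV[R]_n.+1) mxE.
  rewrite -[LHS]/(F (ZV q)) (big_morph F FD F0); apply: eq_bigr => i _.
  case: ifP => // _; rewrite /F.
  have -> : \val (mono (q ord0 i) 0 *: z i) ord0 (l t) =
    mono (q ord0 i) 0 * (\val (z i)) ord0 (l t) by rewrite [LHS]mxE.
  by rewrite scoefMmono // subn0.
pose L : 'M[k]_n := \matrix_(i, t) if A i then
  (if A t then scoef ((\val (z i)) ord0 (l t)) (s t) else 0) else (i == t)%:R.
have LA q t : A t -> (q *m L) ord0 t = scoef ((\val (ZV q)) ord0 (l t)) (s t).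
  move=> tA; rewrite ZVE mxE; apply: eq_bigr => i _; rewrite mxE tA.
  case: ifP => // iA; case: eqP => [it|_]; last by rewrite mulr0.
  by rewrite it tA in iA.
have LnA (q : 'rV[k]_n) t : ~~ A t -> (q *m L) ord0 t = q ord0 t.
  move=> tA; rewrite mxE (bigD1 t) //= mxE (negbTE tA) eqxx mulr1 big1 ?addr0 // => i it.
  by rewrite mxE (negbTE tA) (negbTE it) if_same mulr0.
have ZVD q t h : scoef ((\val (ZV q)) ord0 (l t)) h != 0 -> A t /\ h = s t.
  rewrite ZVE => nz; apply: contrapT => no; case/eqP: nz; apply: big1 => i _.
  case: ifP => // _; apply/eqP; rewrite mulf_eq0; apply/orP; right.
  by apply/contraT => /zD /no.
(* A cycle with vanishing tail is zero, hence so is its image under [f], whose coefficients are the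
   entries of [q] indexed by [A]. *)
have Linj (q : 'rV[k]_n) : q *m L = 0 -> q = 0.
  move=> vL; have ZV0 : ZV q = 0.
    apply: koszul_cycle_eq0 => t; apply: scoef_inj => h; rewrite scoef0.
    apply/eqP/contraT => nz; have [tA hs] := ZVD q t h nz.
    by rewrite hs -LA // vL mxE eqxx in nz.
  apply/rowP => t; rewrite mxE; have [tA|tA] := boolP (A t); last first.
    by rewrite -LnA // vL mxE.
  have : scoef (\val (f (ZV q) t) : R) (s t) = 0 by rewrite ZV0 linear0 ffunE scoef0.
  pose F (x : {ffun 'I_n -> submodule m}) := scoef (\val (x t) : R) (s t).
  have F0 : F 0 = 0 by rewrite /F ffunE scoef0.
  have FD : {morph F : x x' / x + x'} by move=> x x'; rewrite /F -scoefD [(x + x') t]ffunE.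
  have sS : S (s t) by case/asboolP: tA.
  rewrite -[scoef _ _]/(F (f (ZV q))) linear_sum (big_morph F FD F0) (bigD1 t) //= tA.
  have FZ i : F (f (mono (q ord0 i) 0 *: z i)) = q ord0 i * F (B i).
    rewrite linearZ gK /F [(_ *: B i) t]ffunE.
    change (scoef (mono (q ord0 i) 0 * (\val (B i t) : R)) (s t) =
      q ord0 i * scoef (\val (B i t) : R) (s t)).
    by rewrite scoefMmono // subn0.
  rewrite FZ /F BE eqxx tA scoef_mono // eqxx mulr1 big1 ?addr0 // => i it.
  case: ifP => [iA|_]; last by rewrite linear0 -/(F 0) F0.
  by rewrite -/(F _) FZ /F BE eq_sym (negbTE it) scoef0 mulr0.
have Lu : L \in unitmx.
  rewrite -row_free_unit -kermx_eq0; apply/rowV0P => q /sub_kermxP; exact: Linj.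
(* The syzygy of this preimage has tail [t^e] at [j'] and [0] elsewhere, so the cycle equation puts
   [D] into [d ord0 + S]. *)
pose q : 'rV[k]_n := delta_mx ord0 j' *m invmx L; pose x := \val (ZV q).
have vL : q *m L = delta_mx ord0 j' by rewrite mulmxKV.
have sj : s j' = e by rewrite /s /D addKn.
have jA : A j' by apply/asboolP; rewrite -/(s j') sj.
have xj : scoef (x ord0 (l j')) e = 1 by rewrite -[e in LHS]sj -LA // vL mxE !eqxx.
have xl t : t != j' -> x ord0 (l t) = 0.
  move=> tj; apply: scoef_inj => h; rewrite scoef0; apply/eqP/contraT => nz.
  have [tA hs] := ZVD q t h nz.
  by rewrite /x hs -LA // vL mxE (negbTE tj) andbF eqxx in nz.
have /koszul_map0 := valP (ZV q); rewrite -/x (bigD1 j') //= big1 ?addr0 => [x0|t tj]; last first.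
  by rewrite xl // mulr0.
have : scoef (y ord0 * x ord0 ord0) D != 0.
  by rewrite x0 scoefN oppr_eq0 scoef_yM xj mulr1.
rewrite yE scoefMmono //; case: leqP => [le_d|_]; last by rewrite eqxx.
rewrite mulf_eq0 negb_or => /andP[_ /scoef_supp sS].
by exists (D - d ord0)%N; rewrite ?subnKC.
Qed.

End MonomialIdeal.

(** * Equivalence of the seven conditions *)

Theorem theorem1p2 (v : version) (k : fieldType) (a : seq nat)
    (a_pos : forall h, h \in a -> (0 < h)%N)
    (a_increasing : sorted ltn a)
    (a_gcd : \big[gcdn/0%N]_(h <- a) h = 1%N)
    (min_mult : minimal_multiplicity v k a)
    (w : lmodType (nsring v k a)) (w_canonical : canonical_module w)
    (n : nat) (x : 'I_n.+1 -> sg_poly k a) (d : 'I_n.+1 -> nat)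
    (x_homogeneous : forall i, homogeneous (d i) (x i))
    (d_increasing : forall i j : 'I_n.+1, (i < j)%N -> (d i < d j)%N) :
  let R := nsring v k a in
  let y : 'I_n.+1 -> R := fun i => of_graded v (x i) in
  let I : submodClosed R^o := gen (y : 'I_n.+1 -> R^o) in
  let m : submodClosed R^o := max_ideal v k a in
  let t1 : submodClosed R^o := principal (of_graded v (tpow (multiplicity a))) in
  forall (y_minimal : forall i,
            y i \notin submod_span (fun b : R^o => exists2 j, j != i & b = y j))
         (I_nonprincipal : forall b : R, ~ I =i principal b),
  let cond1 (J : submodClosed R^o) := annihilates J (Ext 1 (submodule I) (hom_module (submodule I) w)) in
  let cond2 (J : submodClosed R^o) := annihilates J (Tor 1 (submodule I) (quot_module I)) in
  let cond3 (J : submodClosed R^o) := annihilates J (exterior_square (submodule I)) in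
  let cond4 (J : submodClosed R^o) := {subset ideal_mul J (koszul_boundaries y)
                      <= ideal_mul I (koszul_cycles y)} in
  let cond5 := trace_ideal (submodule I) =i m in
  let cond6 := colon (principal (y ord0)) I =i m in
  let cond7 := graded_isomorphic
    (sub_grading (N := koszul_cycles x)
      (row_grading (fun i => shift_grading (@ring_grading k a) (d i))))
    (sum_grading (fun i : 'I_n => shift_grading
      (sub_grading (N := max_ideal Graded k a) (@ring_grading k a))
      (d (lift ord0 i)))) in
  [<-> cond1 m; cond2 m; cond3 m; cond4 m; cond5; cond6; cond7] /\
  [/\ cond1 m <-> cond1 t1, cond2 m <-> cond2 t1,
      cond3 m <-> cond3 t1 & cond4 m <-> cond4 t1].
Proof.
move=> R y I m t1 y_minimal I_nonprincipal cond1 cond2 cond3 cond4 cond5 cond6 cond7.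
have a_neq0 : a != [::] by apply: contra_eq_neq a_gcd => ->; rewrite big_nil.
have minmult := minimal_multiplicityP a_pos a_neq0 min_mult.
(* Homogeneity makes the generators monomials [c i t^(d i)]; minimality makes the [c i] nonzero and
   the exponents an antichain. *)
pose c i := (\val (x i))`_(d i).
have y_coef i h : scoef (y i) h = if h == d i then c i else 0.
  rewrite scoef_of_graded; case: eqP => [-> //|hd]; apply/eqP/contraT.
  by move=> /x_homogeneous [hd']; case: hd.
have c_neq0 i : c i != 0.
  apply: contraNneq (y_minimal i) => ci0; rewrite (_ : y i = 0); first exact: (submod_in _).1.
  by apply: scoef_inj => h; rewrite y_coef ci0 if_same scoef0.
have dS i : semigroup a (d i).
  by apply: (@scoef_supp v k a (y i)); rewrite y_coef eqxx.
have yE v' i : of_graded v' (x i) = mono v' a (c i) (d i).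
  apply: scoef_inj => h; rewrite scoef_mono // scoef_of_graded -(@scoef_of_graded v).
  exact: y_coef.
have d_antichain i j s : semigroup a s -> d i = (d j + s)%N -> i = j.
  move=> sS dij; apply/eqP/contraT => ij; case/negP: (y_minimal i).
  have -> : y i = (mono v a (c i / c j) s : R) *: (y j : R^o).
    rewrite /y !yE -[RHS]/(_ * _ : R) monoM // divfK // dij addnC.
    by [].
  set N := submod_span _; apply: (submodZ (submod_in N)).
  by apply: submod_span_mem; exists j => //; rewrite eq_sym.
have n_gt0 : (0 < n)%N.
  rewrite lt0n; apply/eqP => n0; apply: (I_nonprincipal (y ord0)) => u.
  have all0 (i : 'I_n.+1) : i = ord0 by apply: val_inj => /=; have := ltn_ord i; lia.
  apply/idP/idP; [apply: (submod_span_ind (submod_in (principal (y ord0))))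
    | apply: (submod_span_ind (submod_in I))] => b.
    by move=> [i ->]; rewrite (all0 i); apply: submod_span_mem.
  by move=> ->; apply: submod_span_mem; exists ord0.
(* Condition (7) concerns the graded ring in both versions, so the monomial form is also needed
   there. *)
have yEv := yE v; have xE := yE Graded.
have TE : of_graded v (tpow (multiplicity a)) = mono v a (1 : k) (multiplicity a) by exact: tpowE.
have Tm : (mono v a (1 : k) (multiplicity a) : R^o) \in m.
  apply/(max_idealE a_pos); apply: supp_mono; last exact: posS_multiplicity.
  by case: (posS_multiplicity a_pos a_neq0).
have Tt1 : (mono v a (1 : k) (multiplicity a) : R^o) \in t1.
  by rewrite /t1 TE; apply: submod_span_mem.
have t1m : {subset t1 <= m}.
  move=> u; apply: (submod_span_ind (submod_in m)) => _ ->.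
  by rewrite TE.
(* Each of (1) to (4) closes a circle: [colon_cond] gives it for [m], restriction for [t1], and this
   gives back [colon_cond]. *)
have P1m : colon_cond a d -> cond1 m.
  move=> st b /(max_idealE a_pos) bm.
  exact: (colon_cond_Ext1 a_pos a_increasing a_neq0 minmult c_neq0 dS d_increasing
    yEv n_gt0 w_canonical st bm).
have P1t : cond1 t1 -> colon_cond a d.
  move=> c1; apply: (Ext1_colon_cond a_pos a_increasing a_neq0 minmult c_neq0 dS d_increasing
    d_antichain yEv n_gt0 w_canonical).
  exact: c1.
have P2m : colon_cond a d -> cond2 m.
  move=> st b /(max_idealE a_pos) bm.
  exact: (colon_cond_Tor1 a_pos a_increasing a_neq0 minmult c_neq0 dS d_increasing
    yEv n_gt0 st bm).
have P2t : cond2 t1 -> colon_cond a d.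
  move=> c2; apply: (Tor1_colon_cond a_pos a_increasing a_neq0 minmult c_neq0 dS d_increasing
    d_antichain yEv n_gt0).
  exact: c2.
have P3m : colon_cond a d -> cond3 m.
  move=> st b /(max_idealE a_pos) bm.
  exact: (colon_cond_exterior a_pos a_increasing a_neq0 minmult c_neq0 dS d_increasing
    yEv n_gt0 st bm).
have P3t : cond3 t1 -> colon_cond a d.
  move=> c3; apply: (exterior_colon_cond a_pos a_increasing a_neq0 minmult c_neq0 dS d_increasing
    d_antichain yEv n_gt0).
  exact: c3.
have P4m : colon_cond a d -> cond4 m.
  exact: (colon_cond_koszul a_pos a_increasing a_neq0 minmult c_neq0 dS d_increasing
    yEv n_gt0 (fun _ => id)).
have P4t : cond4 t1 -> colon_cond a d.
  rewrite /cond4 /t1 TE.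
  exact: (koszul_colon_cond a_pos a_increasing a_neq0 minmult c_neq0 dS d_increasing
    d_antichain yEv n_gt0).
have P5 : colon_cond a d <-> cond5.
  exact: (colon_cond_trace a_pos a_increasing a_neq0 minmult c_neq0 dS d_increasing
    d_antichain yEv n_gt0).
have P6 : colon_cond a d <-> cond6.
  exact: (colon_condP a_pos a_increasing a_neq0 minmult c_neq0 dS d_increasing
    d_antichain yEv n_gt0).
have P7 : colon_cond a d -> cond7.
  exact: (colon_cond_syzygy a_pos a_increasing a_neq0 minmult c_neq0 dS d_increasing
    d_antichain xE n_gt0).
have P7' : cond7 -> colon_cond a d.
  move=> c7; apply: (syzygy_colon_cond a_pos a_increasing a_neq0 c_neq0 dS
    d_antichain xE n_gt0).
  exact: c7.
have S1 : cond1 m -> cond1 t1 by move=> c1 b /t1m; apply: c1.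
have S2 : cond2 m -> cond2 t1 by move=> c2 b /t1m; apply: c2.
have S3 : cond3 m -> cond3 t1 by move=> c3 b /t1m; apply: c3.
have S4 : cond4 m -> cond4 t1.
  move=> c4 z zt; apply: c4; move: z zt.
  set N := ideal_mul m _; apply: (submod_span_ind (submod_in N)) => _ [b [u [/t1m bm uB ->]]].
  by apply: submod_span_mem; exists b, u.
split; last by split; [split=> [/S1|/P1t/P1m] | split=> [/S2|/P2t/P2m]
  | split=> [/S3|/P3t/P3m] | split=> [/S4|/P4t/P4m]].
have Q1 : cond1 m -> colon_cond a d by move=> /S1/P1t.
have Q2 : cond2 m -> colon_cond a d by move=> /S2/P2t.
have Q3 : cond3 m -> colon_cond a d by move=> /S3/P3t.
have Q4 : cond4 m -> colon_cond a d by move=> /S4/P4t.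
by tfae=> [/Q1/P2m|/Q2/P3m|/Q3/P4m|/Q4/P5.1|/P5.2/P6.1|/P6.2/P7|/P7'/P1m].
Qed.
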